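(* Let $\mathcal G$ be a locally finite, connected metric graph, and let $K$ be a closed subspace of $H^1(\mathcal G)$. Then the embedding of $K$ into $L^2(\mathcal G)$ is compact if and only if for every $\varepsilon>0$ there is a finite subgraph $\mathcal G_c$ of $\mathcal G$ such that $$\|f\|_{L^2(\mathcal G\setminus\mathcal G_c)}\le \varepsilon\qquad\text{for all } f\in K \text{ with } \|f\|_{H^1(\mathcal G)}\le 1 .$$
   Context: A metric graph $\mathcal G$ is given by finite or countably infinite sets $V$ of vertices and $E$ of edges, each edge $e$ having a length $\ell_e\in(0,\infty)$; it is obtained from the disjoint union of intervals $[0,\ell_e]$, $e\in E$, by gluing endpoints at the vertices (loops and parallel edges allowed). It carries the shortest-path metric and the sum of the Lebesgue measures on the edges. It is locally finite if every vertex has finite degree. A finite subgraph is a subgraph with finitely many edges. $L^2(\mathcal G)$ is the space of functions with $\|f\|^2_{L^2(\mathcal G)}=\sum_{e}\|f_e\|_{L^2(0,\ell_e)}^2<\infty$, where $f_e$ is the restriction of $f$ to $e$. $H^1(\mathcal G)$ is the Hilbert space of continuous functions $f$ on $\mathcal G$ with $f_e\in H^1(0,\ell_e)$ for all $e\in E$ and $\|f\|_{H^1(\mathcal G)}^2=\sum_e\|f_e\|_{H^1(0,\ell_e)}^2<\infty$. *)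

(* Defs.v *)
From HB Require Import structures.
From mathcomp Require Import all_boot all_order all_algebra.
From mathcomp Require Import all_classical all_reals all_analysis.
From mathcomp Require Import complex.

Set Implicit Arguments.
Unset Strict Implicit.
Unset Printing Implicit Defensive.

Import Order.TTheory GRing.Theory Num.Theory.
Import numFieldNormedType.Exports.

Local Open Scope classical_set_scope.
Local Open Scope complex_scope.
Local Open Scope ring_scope.

(* The orientation src -> tgt of an edge only fixes its parametrization by
   [0, len e]. Loops and parallel edges are allowed. *)
Record metric_graph (R : realType) := MetricGraph {
  vertex : countType;
  edge : countType;
  src : edge -> vertex;
  tgt : edge -> vertex;
  len : edge -> R;
  len_gt0 : forall e, 0 < len e }.

(* The scalar field may be R or C. All functions are complex-valued; in the real
   case they are required to take their values in the real line of R[i]. *)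
Variant scalar_field := RealScalars | ComplexScalars.

Section complex_valued_functions.
Context {R : realType}.
Local Notation mu := (@lebesgue_measure R).

Definition scalars (k : scalar_field) : set R[i] :=
  if k is RealScalars then [set z | complex.Im z = 0] else setT.

Definition sqmod (z : R[i]) : R := complex.Re z ^+ 2 + complex.Im z ^+ 2.

Definition Cmeasurable_fun (D : set R) (u : R -> R[i]) : Prop :=
  measurable_fun D (fun x => complex.Re (u x)) /\
  measurable_fun D (fun x => complex.Im (u x)).

Definition Cintegral (D : set R) (u : R -> R[i]) : R[i] :=
  Rintegral mu D (fun x => complex.Re (u x)) +i*
  Rintegral mu D (fun x => complex.Im (u x)).

Definition sqL2norm (D : set R) (u : R -> R[i]) : \bar R :=
  (\int[mu]_(x in D) (sqmod (u x))%:E)%E.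

Definition L2_interval (l : R) (u : R -> R[i]) : Prop :=
  Cmeasurable_fun `]0, l[ u /\ (sqL2norm `]0%R, l[ u < +oo)%E.

Definition test_function (l : R) (phi : R -> R) : Prop :=
  (forall (n : nat) (x : R), derivable (derive1n n phi) x 1) /\
  exists a b : R,
    [/\ 0 < a, b < l & forall x, x \notin `[a, b] -> phi x = 0].

Definition weak_derivative (l : R) (u g : R -> R[i]) : Prop :=
  forall phi, test_function l phi ->
    Cintegral `]0, l[ (fun x => u x * (derive1 phi x)%:C) =
    - Cintegral `]0, l[ (fun x => g x * (phi x)%:C).

(* The weak derivative is unique up to a null set; wderiv picks one version. *)
Definition wderiv (l : R) (u : R -> R[i]) : R -> R[i] :=
  xget (fun=> 0) [set g | L2_interval l g /\ weak_derivative l u g].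

Definition H1_interval (l : R) (u : R -> R[i]) : Prop :=
  L2_interval l u /\ exists g, L2_interval l g /\ weak_derivative l u g.

Definition sqH1norm_interval (l : R) (u : R -> R[i]) : \bar R :=
  (sqL2norm `]0%R, l[ u + sqL2norm `]0%R, l[ (wderiv l u))%E.

End complex_valued_functions.

Section metric_graphs.
Context {R : realType} (G : metric_graph R).

(* The quotient of the disjoint union of the intervals [0, len e] by the gluing
   of endpoints: every class is either a vertex or a single interior point. *)
Inductive graph_point :=
  | Vertex of vertex G
  | Inner (e : edge G) of {x : R | 0 < x < len e}.

(* The canonical map [0, len e] -> G, extended constantly outside [0, len e]. *)
Definition edge_pt (e : edge G) (x : R) : graph_point :=
  if x <= 0 then Vertex (src e)
  else if insub x is Some y then @Inner e y else Vertex (tgt e).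

(* path_of_length p q l: some path from p to q that is a concatenation of segments of
   edges has length l. *)
Inductive path_of_length : graph_point -> graph_point -> R -> Prop :=
  | path_nil p : path_of_length p p 0
  | path_cons e x y q l :
      x \in `[0, len e] -> y \in `[0, len e] ->
      path_of_length (edge_pt e y) q l -> path_of_length (edge_pt e x) q (`|x - y| + l).

Definition graph_dist (p q : graph_point) : \bar R :=
  ereal_inf [set l%:E | l in [set l | path_of_length p q l]].

Definition connected_graph : Prop := forall p q, exists l, path_of_length p q l.

Definition locally_finite : Prop :=
  forall v : vertex G, finite_set [set e : edge G | src e = v \/ tgt e = v].

Record subgraph := Subgraph {
  sub_vertex : set (vertex G);
  sub_edge : set (edge G);
  sub_src : forall e, sub_edge e -> sub_vertex (src e);
  sub_tgt : forall e, sub_edge e -> sub_vertex (tgt e) }.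

Definition finite_subgraph (H : subgraph) : Prop := finite_set (sub_edge H).

Definition support_of (H : subgraph) : set graph_point :=
  [set p | match p with
           | Vertex v => sub_vertex H v
           | Inner e _ => sub_edge H e
           end].

Definition on_edge (f : graph_point -> R[i]) (e : edge G) : R -> R[i] :=
  fun x => f (edge_pt e x).

Definition continuous_on_graph (f : graph_point -> R[i]) : Prop :=
  forall (p : graph_point) (eps : R), 0 < eps -> exists2 delta : R, 0 < delta &
    forall q, (graph_dist p q < delta%:E)%E -> Num.sqrt (sqmod (f q - f p)) < eps.

(* The norm of L^2(A) for a set A of points of G. *)
Definition L2norm (A : set graph_point) (f : graph_point -> R[i]) : \bar R :=
  sqrte (\esum_(e in [set: edge G])
    sqL2norm (`]0, len e[ `&` edge_pt e @^-1` A) (on_edge f e)).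

Definition H1norm (f : graph_point -> R[i]) : \bar R :=
  sqrte (\esum_(e in [set: edge G]) sqH1norm_interval (len e) (on_edge f e)).

(* Elements of L^2(G) are represented by functions, not by their classes modulo
   equality almost everywhere; the values at the vertices are irrelevant. *)
Definition L2_space (k : scalar_field) : set (graph_point -> R[i]) :=
  [set f | [/\ forall p, scalars k (f p),
               forall e, Cmeasurable_fun `]0, len e[ (on_edge f e)
             & (L2norm setT f < +oo)%E]].

Definition H1_space (k : scalar_field) : set (graph_point -> R[i]) :=
  [set f | [/\ forall p, scalars k (f p),
               continuous_on_graph f,
               forall e, H1_interval (len e) (on_edge f e)
             & (H1norm f < +oo)%E]].

Definition closed_subspace_H1 (k : scalar_field) (K : set (graph_point -> R[i])) :
    Prop :=
  [/\ K `<=` H1_space k,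
      K (fun=> 0),
      forall f g, K f -> K g -> K (fun p => f p + g p),
      forall c f, scalars k c -> K f -> K (fun p => c * f p)
    & forall f, H1_space k f ->
        (forall eps : R, 0 < eps ->
           exists2 g, K g & (H1norm (fun p => f p - g p)%R < eps%:E)%E) ->
        K f].

Definition compact_embedding_L2 (k : scalar_field) (K : set (graph_point -> R[i])) :
    Prop :=
  forall f_ : nat -> graph_point -> R[i],
    (forall n, K (f_ n)) ->
    (exists M : R, forall n, (H1norm (f_ n) <= M%:E)%E) ->
    exists (s : nat -> nat) (f : graph_point -> R[i]),
      [/\ {homo s : m n / (m < n)%N >-> (m < n)%N},
          L2_space k f
        & L2norm setT (fun p => f_ (s n) p - f p) @[n --> \oo] --> 0%E].

End metric_graphs.

(* Main.v *)
(* Compactness gives uniform tails by contradiction: functions violating the tail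
   bound outside larger and larger finite subgraphs have a subsequence converging
   in L^2(G), and the limit has small tails.

   Conversely, let f_n be bounded in H^1(G), and let U be an ultrafilter on the
   indices finer than the Frechet filter. Testing the weak derivative against
   smooth plateaus gives f(y) - f(x) = \int_x^y f' on each edge, so the f_n are
   uniformly bounded and equicontinuous there. Hence they converge along U,
   pointwise and then uniformly on each edge, thus in L^2 of every finite
   subgraph; the uniform tails, which pass to the limit, upgrade this to
   convergence in L^2(G) along U, from which a subsequence is extracted. The same
   identity determines f' up to a null set, hence the H^1 norm, which is defined
   through an arbitrary choice of f', is homogeneous, so that
   the tail condition applies to the normalized f_n. *)
Require Import Defs.
From mathcomp Require Import all_boot all_order all_algebra.
From mathcomp Require Import all_classical all_reals all_analysis.
From mathcomp Require Import measurable_realfun complex ring lra.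

Set Implicit Arguments.
Unset Strict Implicit.
Unset Printing Implicit Defensive.

Import Order.TTheory GRing.Theory Num.Theory.
Import numFieldNormedType.Exports.

Local Open Scope classical_set_scope.
Local Open Scope ring_scope.

(** * Smooth functions *)

Section smooth_functions.
Context {R : realType}.
Implicit Types (f g : R -> R) (t x a b : R) (k n : nat).

(** The functions $t^{-k}e^{-1/t}$ on $t>0$, extended by zero. Together they contain the classical
    $e^{-1/t}$ as [flat 0], and their span is closed under differentiation. *)
Definition flat k t : R := if 0 < t then t^-1 ^+ k * expR (- t^-1) else 0.

Lemma flat_le0 k t : t <= 0 -> flat k t = 0.
Proof. by move=> t0; rewrite /flat ltNge t0. Qed.

Lemma flat_ge0 k t : 0 <= flat k t.
Proof.
rewrite /flat; case: ifP => // t0.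
by rewrite mulr_ge0 ?expR_ge0// exprn_ge0// invr_ge0 ltW.
Qed.

Lemma flat_gt0 k t : 0 < t -> 0 < flat k t.
Proof.
by move=> t0; rewrite /flat t0 mulr_gt0 ?expR_gt0// exprn_gt0// invr_gt0.
Qed.

(** With $y=1/t$, a single term of the exponential series gives $y^{k+2}\le (k+2)!\,e^y$. The
    quadratic bound is what yields differentiability at the origin. *)
Lemma flat_le_sqr k t : flat k t <= k.+2`!%:R * t ^+ 2.
Proof.
have [t0|t0] := leP t 0; first by rewrite flat_le0// mulr_ge0// sqr_ge0.
have y0 : 0 < t^-1 by rewrite invr_gt0.
have H : t^-1 ^+ k.+2 <= k.+2`!%:R * expR t^-1.
  rewrite mulrC -ler_pdivrMr ?ltr0n ?fact_gt0//.
  by apply: le_trans (expR_ge1Dxn k.+1 (ltW y0)); rewrite lerDr.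
rewrite /flat t0 expRN ler_pdivrMr ?expR_gt0//.
have -> : t^-1 ^+ k = t ^+ 2 * t^-1 ^+ k.+2.
  by rewrite -(addn2 k) exprD mulrCA -exprMn divff ?gt_eqF// expr1n mulr1.
by rewrite (mulrAC _ (t ^+ 2)) [leRHS]mulrC ler_wpM2l// sqr_ge0.
Qed.

Lemma is_derive0_sqr f (C : R) :
  (forall x, `|f x| <= C * x ^+ 2) -> is_derive (0 : R) 1 f 0.
Proof.
move=> fC.
have f0 : f 0 = 0.
  by apply/eqP; rewrite -normr_le0 (le_trans (fC 0))// expr0n mulr0.
suff H : h^-1 *: (f (h *: 1 + 0) - f 0) @[h --> 0^'] --> (0 : R).
  by apply: DeriveDef; [apply/cvg_ex; exists 0|exact: cvg_lim H].
apply/cvgr0Pnorm_le => e e0.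
have C1 : 0 < `|C| + 1 by rewrite ltr_wpDl.
near=> h.
have h0 : h != 0 by near: h; exact: nbhs_dnbhs_neq.
have {}h1 : `|h| <= e / (`|C| + 1).
  by near: h; apply: dnbhs0_le; rewrite divr_gt0.
rewrite f0 subr0 addr0 /GRing.scale/= mulr1 normrM normfV.
rewrite mulrC ler_pdivrMr ?normr_gt0//.
apply: (le_trans (fC h)); rewrite -normr_id -real_normK ?num_real//.
rewrite normr_id expr2 mulrA ler_wpM2r//.
rewrite ler_pdivlMr// mulrC in h1; apply: le_trans h1.
by rewrite ler_wpM2r// (le_trans (ler_norm _))// lerDl.
Unshelve. all: by end_near.
Qed.

(** To the left of 0 the function is locally zero and to the right it is locally an elementary
    product; at 0 the quadratic bound forces the derivative to vanish. *)
Lemma is_derive_flat k t :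
  is_derive t 1 (flat k) (flat k.+2 t - k%:R * flat k.+1 t).
Proof.
have [t0|t0|->] := ltgtP t 0.
- rewrite !flat_le0 ?(ltW t0)// mulr0 subr0.
  apply: (near_eq_is_derive (f := cst 0)).
  by near=> x; rewrite flat_le0// ltW//; near: x; exact: lt_nbhsl.
- rewrite /flat t0.
  apply: (near_eq_is_derive (f := (@GRing.inv R) ^+ k * (expR \o (- @GRing.inv R)))).
    near=> x; have -> : 0 < x by near: x; exact: lt_nbhsr.
    by rewrite ?fctE.
  have tN0 : t != 0 by rewrite gt_eqF.
  have dV : is_derive t 1 (@GRing.inv R) (- t^-1 ^+ 2).
    apply: (is_derive_eq (is_deriveV tN0 (is_derive_id _ _))).
    by rewrite /GRing.scale/= mulr1 exprVn.
  apply: is_derive_eq; rewrite ?fctE /=.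
  rewrite /GRing.scale/= ?fctE.
  case: k => [|k] /=; first by rewrite !expr0 expr2 !mul0r; ring.
  by rewrite !exprS; ring.
- rewrite !flat_le0// mulr0 subr0.
  apply: (@is_derive0_sqr _ k.+2`!%:R) => x.
  by rewrite ger0_norm ?flat_ge0// flat_le_sqr.
Unshelve. all: by end_near.
Qed.

(* An inductive class closed under differentiation, so that membership yields
   derivatives of all orders. *)
Inductive smooth : (R -> R) -> Prop :=
  | smooth_flat k : smooth (flat k)
  | smooth_cst c : smooth (fun=> c)
  | smoothD f g : smooth f -> smooth g -> smooth (fun x => f x + g x)
  | smoothM f g : smooth f -> smooth g -> smooth (fun x => f x * g x)
  | smooth_affine f a b : smooth f -> smooth (fun x => f (a * x + b))
  | smoothV f : smooth f -> (forall x, f x != 0) -> smooth (fun x => (f x)^-1).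

Lemma smooth_derive f : smooth f ->
  exists2 g, smooth g & forall x, is_derive x 1 f (g x).
Proof.
elim=> {f} [k|c|f g sf [f' sf' df] sg [g' sg' dg]|f g sf [f' sf' df] sg [g' sg' dg]
  |f a b sf [f' sf' df]|f sf [f' sf' df] f0].
- exists (fun t => flat k.+2 t + (- k%:R) * flat k.+1 t) => [|x].
    by apply: smoothD; [|apply: smoothM; [exact: smooth_cst|]]; exact: smooth_flat.
  by apply: is_derive_eq (is_derive_flat k x) _; rewrite mulNr.
- by exists (fun=> 0) => [|x]; [exact: smooth_cst|exact: is_derive_cst].
- exists (fun x => f' x + g' x) => [|x]; first exact: smoothD.
  exact: is_deriveD.
- exists (fun x => f x * g' x + g x * f' x) => [|x].
    by apply: smoothD; exact: smoothM.
  exact: is_deriveM.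
- exists (fun x => a * f' (a * x + b)) => [|x].
    by apply: smoothM; [exact: smooth_cst|exact: smooth_affine].
  have d : is_derive x 1 (fun x : R => a * x + b) a.
    apply: is_derive_eq
      (is_deriveD (is_deriveZ a (is_derive_id x 1)) (is_derive_cst b x 1)) _.
    by rewrite addr0 /GRing.scale/= mulr1.
  rewrite mulrC; exact: (is_derive1_comp (df _) d).
- exists (fun x => (-1 * (f x)^-1 * (f x)^-1) * f' x) => [|x].
    apply: smoothM => //; apply: smoothM; last exact: smoothV.
    by apply: smoothM; [exact: smooth_cst|exact: smoothV].
  apply: (is_derive_eq (is_deriveV (f0 x) (df x))).
  by rewrite /GRing.scale/= mulN1r mulNr -invfM -expr2.
Qed.

Lemma smooth_derivable f n x : smooth f -> derivable (derive1n n f) x 1.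
Proof.
move=> sf; suff /smooth_derive[g _ /(_ x)[]//] : smooth (derive1n n f).
elim: n => [//|n /smooth_derive[g sg dg]].
rewrite derive1nS (_ : derive1 _ = g)//; apply/funext => y.
by rewrite derive1E; case: (dg y).
Qed.

(** * A smooth step from 0 to 1 *)

Let sden t := flat 0 t + flat 0 (1 - t).

(** The numbers [t] and [1 - t] cannot both be nonpositive. *)
Let sden_gt0 t : 0 < sden t.
Proof.
have [t0|t0] := ltP 0 t; first by rewrite ltr_pwDl ?flat_gt0 ?flat_ge0.
by rewrite ltr_wpDl ?flat_gt0 ?flat_ge0// subr_gt0 (le_lt_trans t0).
Qed.

Definition step t := flat 0 t / sden t.

(** The derivative of [step] by the quotient rule, with [flat 2] as the derivative of [flat 0]. The
    products [flat 2 t * flat 0 t] are already cancelled, which makes nonnegativity visible. *)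
Definition step' t :=
  (flat 2 t * flat 0 (1 - t) + flat 0 t * flat 2 (1 - t)) / sden t ^+ 2.

Lemma smooth_step : smooth step.
Proof.
apply: smoothM; first exact: smooth_flat.
apply: smoothV => [|x]; last by rewrite gt_eqF.
apply: smoothD; first exact: smooth_flat.
have := smooth_affine (-1) 1 (smooth_flat 0).
by under eq_fun do rewrite mulN1r addrC.
Qed.

Lemma is_derive_step t : is_derive t 1 step (step' t).
Proof.
have d0 : is_derive t 1 (flat 0) (flat 2 t).
  by apply: is_derive_eq (is_derive_flat 0 t) _; rewrite mul0r subr0.
have d1 : is_derive t 1 (fun t => flat 0 (1 - t)) (- flat 2 (1 - t)).
  have d : is_derive t 1 (fun x : R => 1 - x) (-1).
    apply: is_derive_eq (is_deriveB (is_derive_cst (1:R) t 1) (is_derive_id t 1)) _.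
    by rewrite sub0r.
  have := @is_derive1_comp _ _ (fun x => 1 - x) _ _ _ (is_derive_flat 0 (1 - t)) d.
  by rewrite mul0r subr0 mulrN1.
have d2 : is_derive t 1 sden (flat 2 t - flat 2 (1 - t)) by exact: is_deriveD.
have s0 : sden t != 0 by rewrite gt_eqF.
apply: is_derive_eq (is_deriveM d0 (is_deriveV s0 d2)) _.
rewrite /step' /GRing.scale/=; move: s0; rewrite /sden => s0.
by field.
Qed.

Lemma step_le0 t : t <= 0 -> step t = 0.
Proof. by move=> t0; rewrite /step flat_le0// mul0r. Qed.

Lemma step_ge1 t : 1 <= t -> step t = 1.
Proof.
move=> t1; have := sden_gt0 t; rewrite /step /sden.
rewrite (@flat_le0 _ (1 - t)) ?subr_le0// addr0 => t0.
by rewrite divff// gt_eqF.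
Qed.

Lemma step_ge0 t : 0 <= step t.
Proof. by rewrite divr_ge0 ?flat_ge0 ?ltW. Qed.

Lemma step_le1 t : step t <= 1.
Proof. by rewrite ler_pdivrMr// mul1r lerDl flat_ge0. Qed.

Lemma step'_ge0 t : 0 <= step' t.
Proof. by rewrite divr_ge0 ?sqr_ge0// addr_ge0// mulr_ge0 ?flat_ge0. Qed.

Lemma step'_le0 t : t <= 0 -> step' t = 0.
Proof. by move=> t0; rewrite /step' !(@flat_le0 _ t)// !mul0r addr0 mul0r. Qed.

Lemma step'_ge1 t : 1 <= t -> step' t = 0.
Proof.
move=> t1; rewrite /step' !(@flat_le0 _ (1 - t)) ?subr_le0//.
by rewrite !mulr0 addr0 mul0r.
Qed.

(** Smoothness of [step] provides some smooth derivative, and uniqueness of derivatives identifies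
    it with the explicit formula. *)
Lemma smooth_step' : smooth step'.
Proof.
have [g sg dg] := smooth_derive smooth_step.
rewrite (_ : step' = g)//; apply/funext => x.
by case: (dg x) => _ <-; case: (is_derive_step x).
Qed.

Lemma smooth_continuous f : smooth f -> continuous f.
Proof.
move=> /smooth_derive[g _ dg] x; apply: differentiable_continuous.
by apply/derivable1_diffP; case: (dg x).
Qed.

End smooth_functions.

(** * Weak derivatives on an interval *)

Section weak_derivative_on_interval.
Context {R : realType}.
Notation mu := (@lebesgue_measure R).
Implicit Types (f g u : R -> R) (t x y l c s A : R).

(** The derivative of [step (c * (t - x))] in [t]: for [c > 0], a one-sided mollifier of mass one
    that lives on [[x, x + 1/c]]. *)
Definition bump c x t := c * step' (c * (t - x)).

Lemma bump_eq0 c x t : 0 < c -> t \notin `[x, x + c^-1] -> bump c x t = 0.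
Proof.
move=> c0; rewrite in_itv/= negb_and -!ltNge /bump => /orP[tx|xt].
  by rewrite step'_le0 ?mulr0// pmulr_rle0// subr_le0 ltW.
rewrite step'_ge1 ?mulr0// -ler_pdivrMl// mulr1 lerBrDr addrC.
exact: ltW.
Qed.

Lemma bump_ge0 c x t : 0 < c -> 0 <= bump c x t.
Proof. by move=> c0; rewrite mulr_ge0 ?step'_ge0// ltW. Qed.

Lemma smooth_bump c x : smooth (bump c x).
Proof.
rewrite /bump; apply: smoothM; first exact: smooth_cst.
have := smooth_affine c (- (c * x)) (@smooth_step' R).
by under eq_fun do rewrite -mulrBr.
Qed.

Lemma smooth_stepM c x : smooth (fun t => step (c * (t - x))).
Proof.
have := smooth_affine c (- (c * x)) (@smooth_step R).
by under eq_fun do rewrite -mulrBr.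
Qed.

Lemma is_derive_stepM c x t : is_derive t 1 (fun t => step (c * (t - x))) (bump c x t).
Proof.
have d : is_derive t 1 (fun t => c * (t - x)) c.
  apply: is_derive_eq
    (is_deriveZ c (is_deriveB (is_derive_id t 1) (is_derive_cst x t 1))) _.
  by rewrite subr0 /GRing.scale/= mulr1.
have := @is_derive1_comp _ _ (fun t => c * (t - x)) _ _ _ (is_derive_step _) d.
by rewrite mulrC.
Qed.

Lemma continuous_integrable_itv f x y : continuous f ->
  mu.-integrable `[x, y] (EFin \o f).
Proof.
move=> cf; apply: continuous_compact_integrable; first exact: segment_compact.
exact: continuous_subspaceT.
Qed.

(** The antiderivative [step (c * (t - x))] rises from 0 to 1 across the interval. *)
Lemma Rintegral_bump c x : 0 < c -> Rintegral mu `[x, x + c^-1] (bump c x) = 1.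
Proof.
move=> c0; rewrite /Rintegral.
have cb := smooth_continuous (smooth_bump c x).
rewrite (@continuous_FTC2 _ _ (fun t => step (c * (t - x)))).
- rewrite /= [in X in _ - X]step_le0 ?subrr ?mulr0// subr0.
  by rewrite step_ge1// (addrC x) addrK divff ?gt_eqF.
- by rewrite ltrDl invr_gt0.
- exact: continuous_subspaceT.
- have cs := smooth_continuous (smooth_stepM c x).
  split; last 2 first.
  + exact/cvg_at_right_filter/cs.
  + exact/cvg_at_left_filter/cs.
  + by move=> t _; case: (is_derive_stepM c x t).
- by move=> t _; rewrite derive1E; case: (is_derive_stepM c x t).
Qed.

Lemma Rintegral_subset f (A B : set R) : A `<=` B ->
  (forall t, B t -> ~ A t -> f t = 0) -> Rintegral mu B f = Rintegral mu A f.
Proof.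
move=> AB f0; rewrite Rintegral_mkcond [RHS]Rintegral_mkcond.
congr (Rintegral _ _ _); apply/funext => t; rewrite !patchE.
have [tB|tB] := pselect (B t); have [tA|tA] := pselect (A t).
- by rewrite !mem_set.
- by rewrite mem_set// memNset// f0.
- by have := AB _ tA.
- by rewrite !memNset.
Qed.

(** Since [bump c x] is a probability density on [[x, x + 1/c]], the integral is a weighted average
    of values of [u] that differ from [u x] by at most [e]. *)
Lemma Rintegral_bump_close u x l c e : {in `]0, l[, continuous u} ->
  0 < x -> x + c^-1 < l -> 0 < c ->
  (forall t, t \in `[x, x + c^-1] -> `|u t - u x| <= e) ->
  `|Rintegral mu `]0, l[ (fun t => u t * bump c x t) - u x| <= e.
Proof.
move=> cu x0 xl c0 ue.
have sub : `[x, x + c^-1] `<=` `]0, l[.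
  move=> t; rewrite /= !in_itv/= => /andP[xt tx].
  by rewrite (lt_le_trans x0)//= (le_lt_trans tx).
have ib : mu.-integrable `[x, x + c^-1] (EFin \o bump c x).
  by apply: continuous_integrable_itv; exact/smooth_continuous/smooth_bump.
have ibk k : mu.-integrable `[x, x + c^-1] (EFin \o (fun t => k * bump c x t)).
  apply: continuous_integrable_itv.
  by apply/smooth_continuous/smoothM; [exact: smooth_cst|exact: smooth_bump].
have iub : mu.-integrable `[x, x + c^-1] (EFin \o (fun t => u t * bump c x t)).
  apply: continuous_compact_integrable; first exact: segment_compact.
  apply: continuous_in_subspaceT => t /set_mem tI.
  apply: cvgM; first by apply: cu; exact: sub.
  exact/smooth_continuous/smooth_bump.
(* The bounds [u x - e] and [u x + e] are rewritten as integrals against the bump, so that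
   monotonicity of the integral applies. *)
have cst k : Rintegral mu `[x, x + c^-1] (fun t => k * bump c x t) = k.
  by rewrite RintegralZl// Rintegral_bump// mulr1.
rewrite (@Rintegral_subset _ `[x, x + c^-1])//; last first.
  by move=> t _ /negP tI; rewrite bump_eq0 ?mulr0.
rewrite ler_distl; apply/andP; split.
  rewrite -[leLHS]cst; apply: le_Rintegral => // t tI.
  rewrite ler_wpM2r ?bump_ge0//.
  by have := ue _ tI; rewrite ler_distl => /andP[].
rewrite -[leRHS]cst; apply: le_Rintegral => // t tI.
rewrite ler_wpM2r ?bump_ge0//.
by have := ue _ tI; rewrite ler_distl => /andP[].
Qed.

Lemma Rintegral_bump_cvg u x l : {in `]0, l[, continuous u} -> x \in `]0, l[ ->
  Rintegral mu `]0, l[ (fun t => u t * bump n.+1%:R x t) @[n --> \oo] --> u x.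
Proof.
move=> cu xl; have /cvgrPdist_le cux := cu _ xl.
move: xl; rewrite in_itv/= => /andP[x0 xl].
apply/cvgrPdist_le => e e0; have [d /= d0 dP] := cux _ e0.
near=> n; rewrite distrC.
have n0 : 0 < n.+1%:R^-1 :> R by rewrite invr_gt0.
apply: Rintegral_bump_close => //.
  rewrite -ltrBrDl; near: n.
  by apply: near_infty_natSinv_lt (PosNum _) => //; rewrite subr_gt0.
move=> t; rewrite in_itv/= => /andP[xt tx]; rewrite distrC; apply: dP => /=.
rewrite ler0_norm ?subr_le0// opprB ltrBlDl (le_lt_trans tx)// ltrD2l.
by near: n; exact: near_infty_natSinv_lt (PosNum d0).
Unshelve. all: by end_near.
Qed.

(** A smooth approximation of the indicator of []x, y]]. Its derivative is a bump at [x] minus a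
    bump at [y], so testing against it isolates [u x - u y]. *)
Definition plateau c x y t := step (c * (t - x)) - step (c * (t - y)).

Lemma derive1_plateau c x y : (plateau c x y)^`()%classic = fun t => bump c x t - bump c y t.
Proof.
apply/funext => t; rewrite derive1E /plateau.
by case: (is_deriveB (is_derive_stepM c x t) (is_derive_stepM c y t)).
Qed.

Lemma smooth_plateau c x y : smooth (plateau c x y).
Proof.
rewrite (_ : plateau c x y = fun t => step (c * (t - x)) + -1 * step (c * (t - y))).
  apply: smoothD; first exact: smooth_stepM.
  by apply: smoothM; [exact: smooth_cst|exact: smooth_stepM].
by apply/funext => t; rewrite mulN1r.
Qed.

Lemma test_function_plateau c x y l : 0 < c -> 0 < x -> x <= y -> y + c^-1 < l ->
  test_function l (plateau c x y).
Proof.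
move=> c0 x0 xy yl; split; first by move=> n t; exact/smooth_derivable/smooth_plateau.
(* Beyond [y + 1/c] both steps have reached 1 and cancel. *)
exists x, (y + c^-1); split => // t.
rewrite in_itv/= negb_and -!ltNge /plateau => /orP[tx|yt].
  rewrite !step_le0 ?subrr// pmulr_rle0// subr_le0 ltW//.
  exact: lt_le_trans tx _.
rewrite !step_ge1 ?subrr// -ler_pdivrMl// mulr1 lerBrDr addrC ltW//.
by rewrite (le_lt_trans _ yt)// lerD2r.
Qed.

Lemma plateau_norm_le1 c x y t : `|plateau c x y t| <= 1.
Proof.
have := step_ge0 (c * (t - x)); have := step_le1 (c * (t - x)).
have := step_ge0 (c * (t - y)); have := step_le1 (c * (t - y)).
by rewrite /plateau ler_norml; lra.
Qed.

(** At [t = x] every term is [step 0 = 0]; hence the strict inequality in the limit and the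
    half-open intervals []x, y]] below. *)
Lemma step_cvg x t :
  step (n.+1%:R * (t - x)) @[n --> \oo] --> ((x < t)%R%:R : R).
Proof.
apply: cvg_near_cst; have [xt|tx] := ltP x t; last first.
  by near=> n; rewrite step_le0// pmulr_rle0// subr_le0.
near=> n; rewrite step_ge1//.
rewrite -ler_pdivrMl// mulr1; apply: ltW; near: n.
by apply: near_infty_natSinv_lt (PosNum _); rewrite subr_gt0.
Unshelve. all: by end_near.
Qed.

(** * The fundamental theorem of calculus for weak derivatives, and uniqueness *)

Lemma continuous_bounded_itv f x y : continuous f -> [bounded f t | t in `]x, y[].
Proof.
move=> cf; have cfs : {within `[x, y], continuous f} by exact: continuous_subspaceT.
have /compact_bounded[M [Mr HM]] := continuous_compact cfs (@segment_compact _ x y).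
exists M; split => // N MN t txy; apply: HM => //=; exists t => //.
exact: subset_itv_oo_cc txy.
Qed.

Lemma integrable_mul_continuous f g x y : mu.-integrable `]x, y[ (EFin \o f) ->
  continuous g -> mu.-integrable `]x, y[ (EFin \o (fun t => f t * g t)).
Proof.
move=> intf cg; have := integrableMl _ intf _ (continuous_bounded_itv x y cg).
apply => //; apply: measurable_funTS; exact: continuous_measurable_fun.
Qed.

(** The real-valued counterpart of [weak_derivative], applied later to real and imaginary parts
    separately. *)
Definition weak_derivativeR l u g := forall phi, test_function l phi ->
  Rintegral mu `]0, l[ (fun x => u x * phi^`()%classic x) =
  - Rintegral mu `]0, l[ (fun x => g x * phi x).

(** Dominated convergence with majorant [|g|]: the plateaus are bounded by 1 and tend pointwise to
    the indicator of []x, y]]. *)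
Lemma Rintegral_plateau_cvg g l x y : mu.-integrable `]0, l[ (EFin \o g) ->
  0 < x -> x <= y -> y < l ->
  Rintegral mu `]0, l[ (fun t => g t * plateau n.+1%:R x y t) @[n --> \oo] -->
  Rintegral mu `]x, y] g.
Proof.
move=> intg x0 xy yl.
pose f t := g t * \1_`]x, y] t.
have -> : Rintegral mu `]x, y] g = Rintegral mu `]0, l[ f.
  rewrite (@Rintegral_subset _ `]x, y] `]0, l[).
  - by apply: eq_Rintegral => t txy; rewrite /f indicE txy mulr1.
  - move=> t /=; rewrite !in_itv/= => /andP[xt ty].
    by rewrite (lt_trans x0)//= (le_lt_trans ty).
  - by move=> t _ txy; rewrite /f indicE memNset// mulr0.
have cp n := smooth_continuous (smooth_plateau n.+1%:R x y).
have ii n := integrable_mul_continuous intg (cp n).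
have mf : measurable_fun `]0, l[ f.
  apply: measurable_funM; first by apply/measurable_EFinP; exact: (measurable_int mu intg).
  exact: measurable_indic.
have [] := @dominated_convergence _ _ _ mu `]0, l[ _
  (fun n t => (g t * plateau n.+1%:R x y t)%:E) (EFin \o f) (fun t => `|g t|%:E).
- by [].
- by move=> n; exact: (measurable_int mu (ii n)).
- exact/measurable_EFinP.
- apply: aeW => t _; apply: cvg_EFin; first exact: nearW.
  rewrite /f /=.
  have -> : \1_`]x, y] t = (x < t)%R%:R - (y < t)%R%:R :> R.
    rewrite indicE mem_setE in_itv/= leNgt; have [yt|] := ltP y t.
      by rewrite (le_lt_trans xy yt) subrr.
    by rewrite andbT subr0.
  by apply: cvgM; [exact: cvg_cst|apply: cvgB; exact: step_cvg].
- exact: (integrable_abse intg).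
- apply: aeW => t n _; rewrite lee_fin normrM ler_piMr//.
  exact: plateau_norm_le1.
move=> intf _ cv.
apply: fine_cvg; rewrite fineK//; exact: integrable_fin_num.
Qed.

(** In the weak identity for steeper and steeper plateaus, the side with [u] tends to [u x - u y] by
    mollification, the side with [g] to minus its integral over []x, y]]. *)
Lemma weak_ftc u g l x y : {in `]0, l[, continuous u} ->
  mu.-integrable `]0, l[ (EFin \o u) -> mu.-integrable `]0, l[ (EFin \o g) ->
  weak_derivativeR l u g -> 0 < x -> x <= y -> y < l ->
  Rintegral mu `]x, y] g = u y - u x.
Proof.
move=> cu intu intg wd x0 xy yl.
have xI : x \in `]0, l[ by rewrite in_itv/= x0 (le_lt_trans xy).
have yI : y \in `]0, l[ by rewrite in_itv/= yl (lt_le_trans x0).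
have cv : - Rintegral mu `]0, l[ (fun t => g t * plateau n.+1%:R x y t) @[n --> \oo]
    --> u x - u y.
  apply: cvg_trans (cvgB (Rintegral_bump_cvg cu xI) (Rintegral_bump_cvg cu yI)).
  apply: near_eq_cvg; near=> n; rewrite /= !fctE.
  rewrite -wd; last first.
    apply: test_function_plateau => //; rewrite -ltrBrDl; near: n.
    by apply: near_infty_natSinv_lt (PosNum _); rewrite subr_gt0.
  have ib z := integrable_mul_continuous intu (smooth_continuous (smooth_bump n.+1%:R z)).
  rewrite derive1_plateau; under [RHS]eq_Rintegral do rewrite mulrBr.
  rewrite RintegralB//; exact: ib.
have -> : u y - u x = - (u x - u y) by rewrite opprB.
rewrite (cvg_unique (@Rhausdorff R) cv (cvgN (Rintegral_plateau_cvg intg x0 xy yl))).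
by rewrite opprK.
Unshelve. all: by end_near.
Qed.

(** By Lebesgue differentiation, the primitive of the zero extension [h] has derivative [h] almost
    everywhere; the hypothesis makes this primitive constant on []0, l[]. *)
Lemma ae0_Rintegral0 f l : mu.-integrable `]0, l[ (EFin \o f) ->
  (forall x y, 0 < x -> x <= y -> y < l -> Rintegral mu `]x, y] f = 0) ->
  f = (fun=> 0) %[ae mu in `]0, l[%classic].
Proof.
move=> intf f0; pose h := f \_ `]0, l[.
have inth : mu.-integrable setT (EFin \o h).
  by move: intf; rewrite integrable_mkcond// restrict_EFin.
have iNy y : mu.-integrable `]-oo, y] (EFin \o h) by exact: integrableS inth.
have loch : locally_integrable setT h by exact: integrable_locally.
have := FTC1Ny iNy loch; apply: filterS; first exact: (ae_filter_ringOfSetsType mu).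
move=> x [_ +] xI; rewrite {2}/h patchE mem_set// => <-.
pose F x := Rintegral mu `]-oo, x] h.
have Fcst y z : y \in `]0, l[ -> z \in `]0, l[ -> F y = F z.
  wlog yz : y z / y <= z.
    by move=> H yI zI; have [|/ltW] := leP y z => yz; [|apply/esym]; exact: H.
  rewrite !in_itv/= => /andP[y0 _] /andP[_ zl]; apply/esym/eqP; rewrite -subr_eq0.
  rewrite /F (@Rintegral_itvB _ h -oo%O (BRight z) y)//.
  rewrite -[X in _ == X](f0 y z)//; apply/eqP/eq_Rintegral => t.
  rewrite inE/= in_itv/= => /andP[yt tz].
  by rewrite /h patchE mem_set//= in_itv/= (lt_trans y0)//= (le_lt_trans tz).
apply/esym; have -> : 0 = (cst (F x) : R -> R)^`()%classic x.
  by rewrite derive1E derive_cst.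
rewrite !derive1E; apply: near_eq_derive.
near=> t; apply: Fcst => //; near: t.
exact: near_in_itvoo.
Unshelve. all: by end_near.
Qed.

(** By [weak_ftc], [h] and [c * g] both integrate over []x, y]] to [c * (u y - u x)]. This is
    uniqueness of the weak derivative, combined with scaling. *)
Lemma weak_derivativeRZ_ae u g h l c : {in `]0, l[, continuous u} ->
  mu.-integrable `]0, l[ (EFin \o u) ->
  mu.-integrable `]0, l[ (EFin \o g) -> mu.-integrable `]0, l[ (EFin \o h) ->
  weak_derivativeR l u g -> weak_derivativeR l (fun t => c * u t) h ->
  h = (fun t => c * g t) %[ae mu in `]0, l[%classic].
Proof.
move=> cu intu intg inth wg wh.
have intZ f : mu.-integrable `]0, l[ (EFin \o f) ->
    mu.-integrable `]0, l[ (EFin \o (fun t => c * f t)).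
  by move=> intf; have := integrableZl _ c intf; apply.
have icg := intZ _ intg.
have ccu : {in `]0, l[, continuous (fun t => c * u t)}.
  by move=> t tI; apply: cvgM; [exact: cvg_cst|exact: cu].
have : (fun t => h t - c * g t) = (fun=> 0) %[ae mu in `]0, l[%classic].
  apply: ae0_Rintegral0 => [|x y x0 xy yl].
    by have := integrableB _ inth icg; apply.
  have sub : `]x, y] `<=` `]0, l[.
    move=> t /=; rewrite !in_itv/= => /andP[xt ty].
    by rewrite (lt_trans x0)//= (le_lt_trans ty).
  rewrite RintegralB//; last 2 first.
  - exact: integrableS inth.
  - exact: integrableS icg.
  rewrite RintegralZl//; last exact: integrableS intg.
  rewrite (weak_ftc cu intu intg)// (weak_ftc ccu (intZ _ intu) inth)//.
  by rewrite mulrBr subrr.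
apply: filterS; first exact: (ae_filter_ringOfSetsType mu).
by move=> t H /H/eqP; rewrite subr_eq0 => /eqP.
Qed.

(** * Pointwise bounds from the energy *)

Lemma lebesgue_measure_itv_lty (b c : bool) x y :
  (mu [set` Interval (BSide b x) (BSide c y)] < +oo)%E.
Proof. by rewrite lebesgue_measure_itv/=; case: ifP => _ //; exact: ltry. Qed.

Lemma integrable_sqr f l : measurable_fun `]0, l[ f ->
  (\int[mu]_(t in `]0%R, l[) (f t ^+ 2)%:E < +oo)%E ->
  mu.-integrable `]0, l[ (EFin \o (fun t => f t ^+ 2)).
Proof.
move=> mf f2; apply/integrableP; split.
  by apply/measurable_EFinP; exact: measurable_funX.
by under eq_integral do rewrite /= ger0_norm ?sqr_ge0//.
Qed.

(** The interval has finite length and $|f|\le f^2+1$. *)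
Lemma integrable_of_sqr f l : measurable_fun `]0, l[ f ->
  (\int[mu]_(t in `]0%R, l[) (f t ^+ 2)%:E < +oo)%E ->
  mu.-integrable `]0, l[ (EFin \o f).
Proof.
move=> mf f2.
have i1 : mu.-integrable `]0, l[ (EFin \o (fun=> 1 : R)).
  apply: measurable_bounded_integrable => //.
    exact: lebesgue_measure_itv_lty.
  by exists 1; split => // M M1 t _; rewrite /= normr1 ltW.
apply: le_integrable (integrableD _ (integrable_sqr mf f2) i1) => //.
  exact/measurable_EFinP.
move=> t _; rewrite /= lee_fin [leRHS]ger0_norm ?addr_ge0 ?sqr_ge0//.
rewrite -[f t ^+ 2]real_normK ?num_real//; have := normr_ge0 (f t).
by move: `|f t| => z z0; nra.
Qed.

(** A linearized Cauchy-Schwarz inequality: integrate $|g|\le s g^2+1/s$. Keeping [s] free avoids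
    square roots. *)
Lemma le_Rintegral_sqr g l A s x y : measurable_fun `]0, l[ g ->
  (\int[mu]_(t in `]0%R, l[) (g t ^+ 2)%:E <= A%:E)%E -> 0 < s ->
  0 < x -> x <= y -> y < l ->
  `|Rintegral mu `]x, y] g| <= s * A + (y - x) / s.
Proof.
move=> mg gA s0 x0 xy yl.
have gfin := le_lt_trans gA (ltry A).
have sub : `]x, y] `<=` `]0, l[.
  move=> t /=; rewrite !in_itv/= => /andP[xt ty].
  by rewrite (lt_trans x0)//= (le_lt_trans ty).
have ig : mu.-integrable `]x, y] (EFin \o g).
  by apply: integrableS (integrable_of_sqr mg gfin).
have ig2D := integrable_sqr mg gfin.
have ig2 : mu.-integrable `]x, y] (EFin \o (fun t => g t ^+ 2)).
  exact: integrableS ig2D.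
have i1 : mu.-integrable `]x, y] (EFin \o (fun=> s^-1 : R)).
  apply: measurable_bounded_integrable => //.
    exact: lebesgue_measure_itv_lty.
  by exists `|s^-1|; split => // M M1 t _; rewrite /= ltW.
apply: le_trans (le_normr_Rintegral _ ig) _ => //.
have isg : mu.-integrable `]x, y] (EFin \o (fun t => s * g t ^+ 2)).
  by have := integrableZl _ s ig2; apply.
apply: (@le_trans _ _ (Rintegral mu `]x, y] (fun t => s * g t ^+ 2 + s^-1))).
  apply: le_Rintegral => //.
  - by have := integrable_norm ig; apply.
  - by have := integrableD _ isg i1; apply.
  - move=> t _; rewrite -[g t ^+ 2]real_normK ?num_real//.
    have := normr_ge0 (g t); move: `|g t| => z z0.
    (* AM-GM in the form [z <= s z^2 + 1/s] *)
    have : 0 <= s^-1 * ((s * z - 1) ^+ 2 + s * z).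
      apply: mulr_ge0; first by rewrite invr_ge0 ltW.
      by rewrite addr_ge0 ?sqr_ge0// mulr_ge0// ltW.
    have s1 : s != 0 by rewrite gt_eqF.
    have -> : s^-1 * ((s * z - 1) ^+ 2 + s * z) = s * z ^+ 2 + s^-1 - z by field.
    by rewrite subr_ge0.
have E : Rintegral mu `]x, y] (fun=> s^-1) = s^-1 * fine (mu `]x, y]).
  exact: Rintegral_cst.
rewrite RintegralD// RintegralZl// E lebesgue_measure_itv/= lte_fin.
apply: lerD.
  rewrite ler_wpM2l ?(ltW s0)// -lee_fin /Rintegral fineK; last first.
    exact: integrable_fin_num.
  apply: le_trans gA; apply: ge0_subset_integral => //.
    by case/integrableP : ig2D.
  by move=> t _; rewrite lee_fin sqr_ge0.
have [xy'|yx] := ltP x y; first by rewrite /= mulrC.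
by rewrite /= mulr0 mulr_ge0 ?subr_ge0// invr_ge0 ltW.
Qed.

(** Combines [weak_ftc] with the preceding estimate. The modulus depends on the functions only
    through [A], so it is common to a family of bounded energy. *)
Lemma weak_modulus u g l A s x y : {in `]0, l[, continuous u} ->
  mu.-integrable `]0, l[ (EFin \o u) -> measurable_fun `]0, l[ g ->
  (\int[mu]_(t in `]0%R, l[) (g t ^+ 2)%:E <= A%:E)%E ->
  weak_derivativeR l u g -> 0 < s -> x \in `]0, l[ -> y \in `]0, l[ ->
  `|u x - u y| <= s * A + `|x - y| / s.
Proof.
move=> cu intu mg gA wd s0.
wlog xy : x y / x <= y.
  move=> H xI yI; have [|/ltW] := leP x y => xy; first exact: H.
  by rewrite distrC (distrC x); exact: H.
rewrite !in_itv/= => /andP[x0 _] /andP[_ yl].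
rewrite distrC (distrC x) (@ger0_norm _ (y - x)) ?subr_ge0//.
have ig := integrable_of_sqr mg (le_lt_trans gA (ltry A)).
by rewrite -(weak_ftc cu intu ig wd)//; exact: (le_Rintegral_sqr mg gA).
Qed.

(** Put [B = A / l + 1]. If [|u x|] exceeded [A + l + B], the modulus with [s = 1] would give
    [|u| >= B] on the whole interval, hence $B^2 l\le A=(B-1)l$, which is impossible. *)
Lemma weak_bound u g l A x : {in `]0, l[, continuous u} ->
  measurable_fun `]0, l[ u -> measurable_fun `]0, l[ g ->
  (\int[mu]_(t in `]0%R, l[) (u t ^+ 2)%:E <= A%:E)%E ->
  (\int[mu]_(t in `]0%R, l[) (g t ^+ 2)%:E <= A%:E)%E ->
  weak_derivativeR l u g -> 0 < l -> x \in `]0, l[ ->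
  `|u x| <= A + l + (A / l + 1).
Proof.
move=> cu mu' mg uA gA wd l0 xI.
have A0 : 0 <= A.
  by rewrite -lee_fin (le_trans _ uA)// integral_ge0// => t _; rewrite lee_fin sqr_ge0.
have intu := integrable_of_sqr mu' (le_lt_trans uA (ltry A)).
pose B := A / l + 1; have B1 : 1 <= B by rewrite lerDr divr_ge0// ltW.
rewrite leNgt; apply/negP => ux.
have uB t : t \in `]0, l[ -> B ^+ 2 <= u t ^+ 2.
  move=> tI; rewrite -[u t ^+ 2]real_normK ?num_real//.
  rewrite lerXn2r ?nnegrE//; first by rewrite (le_trans _ B1).
  have := weak_modulus cu intu mg gA wd ltr01 xI tI.
  rewrite mul1r invr1 mulr1.
  have : `|x - t| <= l.
    by move: xI tI; rewrite !in_itv/= ler_norml => /andP[? ?] /andP[? ?]; lra.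
  have := ler_normB (u x - u t) (- u t); rewrite opprK subrK normrN.
  by move: ux; rewrite -/B; lra.
have : ((B ^+ 2 * l)%:E <= A%:E)%E.
  apply: le_trans uA.
  have -> : (B ^+ 2 * l)%:E = (\int[mu]_(t in `]0%R, l[) (B ^+ 2)%:E)%E.
    rewrite integral_cst// [X in (_ * X)%E](_ : _ = l%:E)//.
    by have := @lebesgue_measure_itv R `]0, l[; rewrite /= lte_fin l0 sube0.
  apply: ge0_le_integral => //.
  - by move=> t _; rewrite lee_fin sqr_ge0.
  - exact/measurable_EFinP/measurable_funX.
rewrite lee_fin; apply/negP; rewrite -ltNge.
have -> : A = (B - 1) * l by rewrite /B addrK divfK// gt_eqF.
by rewrite ltr_pM2r//; nra.
Qed.

End weak_derivative_on_interval.

(** * Complex-valued functions on an interval *)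

Section complex_interval.
Context {R : realType}.
Notation mu := (@lebesgue_measure R).
Implicit Types (u v g : R -> R[i]) (D : set R) (l c s A e x y : R) (z w : R[i]) (b : bool).

(* The two real components, indexed by a boolean so that they are treated alike. *)
Definition reim b z : R := if b then complex.Re z else complex.Im z.

Lemma sqmodE z : sqmod z = reim true z ^+ 2 + reim false z ^+ 2.
Proof. by []. Qed.

Lemma reimB b z w : reim b (z - w) = reim b z - reim b w.
Proof. by case: b z w => -[? ?] [? ?]. Qed.

Lemma reimZ b c z : reim b (c%:C%C * z) = c * reim b z.
Proof. by case: b z => -[p q] /=; rewrite mul0r ?subr0 ?addr0. Qed.

Lemma sqmod_ge0 z : 0 <= sqmod z.
Proof. by rewrite addr_ge0 ?sqr_ge0. Qed.

Lemma sqr_reim_le b z : reim b z ^+ 2 <= sqmod z.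
Proof. by case: b; rewrite /sqmod /= ?lerDl ?lerDr sqr_ge0. Qed.

(** In each component, $2q^2+2(p-q)^2-p^2=(p-2q)^2$. This squared triangle inequality can be
    integrated and summed over edges directly, in place of Minkowski's inequality. *)
Lemma sqmod_le2 z w : sqmod z <= 2 * sqmod w + 2 * sqmod (z - w).
Proof.
have H p q : p ^+ 2 <= 2 * q ^+ 2 + 2 * (p - q) ^+ 2 :> R.
  by rewrite -subr_ge0 (_ : _ - _ = (p - 2 * q) ^+ 2) ?sqr_ge0//; ring.
rewrite !sqmodE !reimB; have := H (reim true z) (reim true w).
by have := H (reim false z) (reim false w); lra.
Qed.

Lemma CmeasurableP D u :
  Cmeasurable_fun D u <-> forall b, measurable_fun D (fun x => reim b (u x)).
Proof. by split=> [[? ?] []//|H]; split; [exact: (H true)|exact: (H false)]. Qed.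

Lemma measurable_reim b D u :
  Cmeasurable_fun D u -> measurable_fun D (fun x => reim b (u x)).
Proof. by move=> /CmeasurableP; exact. Qed.

Lemma CmeasurableB D u v : Cmeasurable_fun D u -> Cmeasurable_fun D v ->
  Cmeasurable_fun D (fun x => u x - v x).
Proof.
move=> /CmeasurableP mu' /CmeasurableP mv; apply/CmeasurableP => b.
by under eq_fun do rewrite reimB; exact: measurable_funB.
Qed.

Lemma CmeasurableZ D u c :
  Cmeasurable_fun D u -> Cmeasurable_fun D (fun x => c%:C%C * u x).
Proof.
move=> mu'; apply/CmeasurableP => b.
rewrite (_ : (fun x => reim b _) = fun x => c * reim b (u x)).
  by apply: measurable_funM => //; exact: measurable_reim.
by apply/funext => x; rewrite reimZ.
Qed.

Lemma measurable_sqmod D u : Cmeasurable_fun D u ->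
  measurable_fun D (fun x => (sqmod (u x))%:E).
Proof.
move=> [mr mi]; apply/measurable_EFinP.
by apply: measurable_funD; exact: measurable_funX.
Qed.

Lemma sqL2norm_ge0 D u : (0 <= sqL2norm D u)%E.
Proof. by apply: integral_ge0 => x _; rewrite lee_fin sqmod_ge0. Qed.

Lemma integral_sqr_reim_le b D u : measurable D -> Cmeasurable_fun D u ->
  (\int[mu]_(x in D) (reim b (u x) ^+ 2)%:E <= sqL2norm D u)%E.
Proof.
move=> mD mu'; apply: ge0_le_integral => //.
- by move=> x _; rewrite lee_fin sqr_ge0.
- apply/measurable_EFinP; apply: measurable_funX.
  exact: measurable_reim.
- exact: measurable_sqmod.
- by move=> x _; rewrite lee_fin sqr_reim_le.
Qed.

Lemma sqL2normZ D u c : measurable D -> Cmeasurable_fun D u ->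
  sqL2norm D (fun x => c%:C%C * u x) = ((c ^+ 2)%:E * sqL2norm D u)%E.
Proof.
move=> mD mu'; rewrite /sqL2norm -ge0_integralZl//.
- apply: eq_integral => x _.
  by rewrite -EFinM !sqmodE !reimZ !exprMn mulrDr.
- exact: measurable_sqmod.
- by move=> x _; rewrite lee_fin sqmod_ge0.
- by rewrite lee_fin sqr_ge0.
Qed.

Lemma sqL2norm_le2 D u v : measurable D ->
  Cmeasurable_fun D u -> Cmeasurable_fun D v ->
  (sqL2norm D u <= 2%:E * sqL2norm D v + 2%:E * sqL2norm D (fun x => u x - v x)%R)%E.
Proof.
move=> mD mu' mv; have muv := CmeasurableB mu' mv.
have m2 (w : R -> R[i]) : Cmeasurable_fun D w ->
    measurable_fun D (fun x => (2%:E * (sqmod (w x))%:E)%E).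
  by move=> mw; apply: emeasurable_funM; [exact: measurable_cst|exact: measurable_sqmod].
rewrite /sqL2norm -!ge0_integralZl//; last 4 first.
- exact: measurable_sqmod.
- by move=> x _; rewrite lee_fin sqmod_ge0.
- exact: measurable_sqmod.
- by move=> x _; rewrite lee_fin sqmod_ge0.
rewrite -ge0_integralD//; last 4 first.
- by move=> x _; rewrite mule_ge0// lee_fin sqmod_ge0.
- exact: m2.
- by move=> x _; rewrite mule_ge0// lee_fin sqmod_ge0.
- exact: m2.
apply: ge0_le_integral => //.
- by move=> x _; rewrite lee_fin sqmod_ge0.
- exact: measurable_sqmod.
- by apply: emeasurable_funD; exact: m2.
- by move=> x _; rewrite -!EFinM -EFinD lee_fin sqmod_le2.
Qed.

Lemma sqL2norm_bounded l u e : 0 < l -> 0 <= e -> Cmeasurable_fun `]0, l[ u ->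
  (forall b x, x \in `]0, l[ -> `|reim b (u x)| <= e) ->
  (sqL2norm `]0%R, l[ u <= (2 * e ^+ 2 * l)%:E)%E.
Proof.
move=> l0 e0 mu' ue.
have -> : (2 * e ^+ 2 * l)%:E = (\int[mu]_(t in `]0%R, l[) (2 * e ^+ 2)%:E)%E.
  rewrite integral_cst// [X in (_ * X)%E](_ : _ = l%:E)//.
  by have := @lebesgue_measure_itv R `]0, l[; rewrite /= lte_fin l0 sube0.
apply: ge0_le_integral => //.
- by move=> x _; rewrite lee_fin sqmod_ge0.
- exact: measurable_sqmod.
- move=> x xI; rewrite lee_fin sqmodE mulr2n mulrDl mul1r.
  by apply: lerD; rewrite -real_normK ?num_real// lerXn2r ?nnegrE//; exact: ue.
Qed.

(** Test functions are real, so multiplying by them commutes with taking components. *)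
Lemma weak_derivative_reim l u g b : weak_derivative l u g ->
  weak_derivativeR l (fun x => reim b (u x)) (fun x => reim b (g x)).
Proof.
move=> wd phi tphi; have := wd phi tphi; rewrite /Cintegral.
have E (h : R -> R[i]) (k : R -> R) b' :
    Rintegral mu `]0, l[ (fun x => reim b' (h x * (k x)%:C%C)) =
    Rintegral mu `]0, l[ (fun x => reim b' (h x) * k x).
  by apply: eq_Rintegral => x _; rewrite mulrC reimZ mulrC.
case=> Hr Hi; case: b.
  by rewrite -(E u) -(E g); exact: Hr.
by rewrite -(E u) -(E g); exact: Hi.
Qed.

Lemma wderivP l u : H1_interval l u ->
  L2_interval l (wderiv l u) /\ weak_derivative l u (wderiv l u).
Proof.
by move=> [_ [g gP]]; rewrite /wderiv; case: xgetP => [h _ //|/(_ g)/(_ gP)].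
Qed.

Lemma integrable_reim l u b : L2_interval l u ->
  mu.-integrable `]0, l[ (EFin \o (fun x => reim b (u x))).
Proof.
move=> [mu' u2]; apply: integrable_of_sqr.
  exact: measurable_reim.
exact: le_lt_trans (integral_sqr_reim_le b _ mu') u2.
Qed.

Lemma H1_modulus l u A s x y b :
  (forall b, {in `]0, l[, continuous (fun x => reim b (u x))}) ->
  H1_interval l u -> (sqH1norm_interval l u <= A%:E)%E -> 0 < s ->
  x \in `]0, l[ -> y \in `]0, l[ ->
  `|reim b (u x) - reim b (u y)| <= s * A + `|x - y| / s.
Proof.
move=> cu Hu uA s0 xI yI; have [L2g wd] := wderivP Hu.
apply: (weak_modulus (cu b) _ _ _ (weak_derivative_reim b wd)) => //.
- by apply: integrable_reim; case: Hu.
- exact: measurable_reim L2g.1.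
- apply: le_trans (integral_sqr_reim_le b _ L2g.1) _ => //.
  by apply: le_trans uA; rewrite leeDr// sqL2norm_ge0.
Qed.

Lemma H1_bound l u A x b : 0 < l ->
  (forall b, {in `]0, l[, continuous (fun x => reim b (u x))}) ->
  H1_interval l u -> (sqH1norm_interval l u <= A%:E)%E -> x \in `]0, l[ ->
  `|reim b (u x)| <= A + l + (A / l + 1).
Proof.
move=> l0 cu Hu uA xI; have [L2g wd] := wderivP Hu; have [[mu' _] _] := Hu.
apply: (weak_bound (cu b) _ _ _ _ (weak_derivative_reim b wd)) => //.
- exact: measurable_reim.
- exact: measurable_reim L2g.1.
- apply: le_trans (integral_sqr_reim_le b _ mu') _ => //.
  by apply: le_trans uA; rewrite leeDl// sqL2norm_ge0.
- apply: le_trans (integral_sqr_reim_le b _ L2g.1) _ => //.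
  by apply: le_trans uA; rewrite leeDr// sqL2norm_ge0.
Qed.

(** The versions of the weak derivative chosen for [u] and for [c * u] are unrelated as functions;
    uniqueness makes them proportional almost everywhere, which suffices under the integral. *)
Lemma sqH1norm_intervalZ l u c :
  (forall b, {in `]0, l[, continuous (fun x => reim b (u x))}) ->
  H1_interval l u -> H1_interval l (fun x => c%:C%C * u x) ->
  sqH1norm_interval l (fun x => c%:C%C * u x) =
  ((c ^+ 2)%:E * sqH1norm_interval l u)%E.
Proof.
move=> cu Hu Hcu; have [L2u _] := Hu.
have [L2g wg] := wderivP Hu; have [L2h wh] := wderivP Hcu.
rewrite /sqH1norm_interval ge0_muleDr ?sqL2norm_ge0//.
rewrite sqL2normZ//; last exact: L2u.1.
congr (_ + _)%E; rewrite -sqL2normZ//; last exact: L2g.1.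
have hg b : (fun t => reim b (wderiv l (fun x => c%:C%C * u x) t)) =
    (fun t => c * reim b (wderiv l u t)) %[ae mu in `]0, l[%classic].
  apply: (weak_derivativeRZ_ae (cu b));
    [exact: integrable_reim..|exact: weak_derivative_reim|].
  rewrite (_ : (fun t => c * reim b (u t)) = fun t => reim b (c%:C%C * u t)).
    exact: weak_derivative_reim.
  by apply/funext => t; rewrite reimZ.
apply: ge0_ae_eq_integral => //.
- exact: (measurable_sqmod L2h.1).
- exact: (measurable_sqmod (CmeasurableZ _ L2g.1)).
- by move=> x _; rewrite lee_fin sqmod_ge0.
- by move=> x _; rewrite lee_fin sqmod_ge0.
move: (hg true) (hg false).
apply: filterS2; first exact: (ae_filter_ringOfSetsType mu).
move=> x ht hf xI.
by rewrite !sqmodE ht// hf// !reimZ.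
Qed.

End complex_interval.

(** * Extended sums and ultrafilters *)

Section sums.
Context {R : realType} {T : choiceType}.
Implicit Types (S : set T) (a b c : T -> \bar R).
Local Open Scope ereal_scope.

Lemma esum_le_ub S a (M : \bar R) :
  (forall X, fsets S X -> \sum_(i \in X) a i <= M) -> \esum_(i in S) a i <= M.
Proof. by move=> H; apply: ge_ereal_sup => _ [X SX <-]; exact: H. Qed.

Lemma esum_sub S S' a : (forall i, 0 <= a i) -> S `<=` S' ->
  \esum_(i in S) a i <= \esum_(i in S') a i.
Proof.
move=> a0 SS'; apply: esum_le_ub => X [Xf XS].
by apply: esum_ge; exists X => //; split => //; exact: subset_trans SS'.
Qed.

Lemma le_esum_term S a i : S i -> (forall i, 0 <= a i) -> a i <= \esum_(j in S) a j.
Proof.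
move=> Si a0; rewrite -[leLHS](@esum_set1 _ _ i a)//.
by apply: esum_sub => // j ->.
Qed.

Lemma esumZl_le S a (c : R) : (forall i, 0 <= a i) -> (0 <= c)%R ->
  \esum_(i in S) (c%:E * a i) <= c%:E * \esum_(i in S) a i.
Proof.
move=> a0 c0; apply: esum_le_ub => X SX.
rewrite -ge0_mule_fsumr// lee_wpmul2l ?lee_fin//.
by apply: ereal_sup_ubound; exists X.
Qed.

(** The summed form of the squared triangle inequality: [a] and [b] stand for the energies of a
    reference function and of the difference. *)
Lemma esum_le2 S a b c (A B : R) : (forall i, 0 <= a i) -> (forall i, 0 <= b i) ->
  (forall i, c i <= 2%:E * a i + 2%:E * b i) ->
  \esum_(i in S) a i <= A%:E -> \esum_(i in S) b i <= B%:E ->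
  \esum_(i in S) c i <= (2 * A + 2 * B)%:E.
Proof.
move=> a0 b0 cab aA bB.
have le2 d (D : R) : (forall i, 0 <= d i) -> \esum_(i in S) d i <= D%:E ->
    \esum_(i in S) (2%:E * d i) <= (2 * D)%:E.
  move=> d0 dD; rewrite EFinM; apply: le_trans (esumZl_le _ d0 _) _ => //.
  by rewrite lee_wpmul2l ?lee_fin.
have g2 d : (forall i, 0 <= d i) -> forall i, S i -> 0 <= 2%:E * d i.
  by move=> d0 i _; rewrite mule_ge0// lee_fin.
apply: (@le_trans _ _ (\esum_(i in S) (2%:E * a i + 2%:E * b i))).
  exact: le_esum.
rewrite esumD//; [|exact: g2..].
by rewrite (EFinD (2 * A)%R); apply: leeD; exact: le2.
Qed.

End sums.

(** * Countable index sets and limits along ultrafilters *)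

Lemma finite_pickle_lt (T : countType) (n : nat) :
  finite_set [set i : T | (pickle i < n)%N].
Proof.
apply: (@finite_preimage _ _ `I_n pickle) => //.
by move=> i j _ _; exact: (pcan_inj pickleK).
Qed.

Lemma finite_set_pickle_lt (T : countType) (X : set T) : finite_set X ->
  exists n, X `<=` [set i | (pickle i < n)%N].
Proof.
move=> /finite_fsetP[F ->].
exists (\max_(i <- finmap.enum_fset F) (pickle i).+1)%N => i /= iF.
by rewrite (big_rem i)//= leq_max leqnn.
Qed.

(** Some finite partial sum comes within [e] of the total. Its indices lie in an initial segment of
    the enumeration [pickle], so at most [e] is left outside that segment. *)
Lemma esum_tail (R : realType) (T : countType) (a : T -> \bar R) (e : R) :
  (forall i, 0 <= a i)%E -> (\esum_(i in [set: T]) a i < +oo)%E -> 0 < e ->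
  exists n, (\esum_(i in ~` [set i | (pickle i < n)%N]) a i <= e%:E)%E.
Proof.
move=> a0 afin e0.
have s0 S : (0 <= \esum_(i in S) a i)%E by exact: esum_ge0.
have fin S : (\esum_(i in S) a i)%E \is a fin_num.
  by rewrite ge0_fin_numE//; apply: le_lt_trans afin; exact: esum_sub.
have [_ [X [Xf _] <-] Xe] := ub_ereal_sup_adherent e0 (fin setT).
have [n Xn] := finite_set_pickle_lt Xf; exists n.
have := esumID [set i | (pickle i < n)%N] setT a (fun i _ => a0 i).
rewrite !setTI => E.
move: Xe; rewrite -/(esum setT a) E.
have := esum_ge (ex_intro2 _ _ X (conj Xf Xn) (lexx (\sum_(i \in X) a i)%E)).
rewrite -(fineK (fin [set i | (pickle i < n)%N])) -(fineK (fin (~` _))).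
move=> h1 h2; have := lt_le_trans h2 h1.
by rewrite -!EFinD lte_fin lee_fin => ?; lra.
Qed.

(** Compactness of [[-C, C]] gives a cluster point. Along an ultrafilter it is a limit: otherwise
    the complement of some neighbourhood would have its preimage in [U]. *)
Lemma ultra_bounded_cvg (R : realType) (U : set_system nat) (a : nat -> R) (C : R) :
  UltraFilter U -> (forall n, `|a n| <= C) -> exists l : R, a n @[n --> U] --> l.
Proof.
move=> UU aC.
have FI : U (a @^-1` [set` `[- C, C]]).
  by apply: (@filterE _ U) => n; rewrite /= in_itv/= -ler_norml; exact: aC.
have [p [_ clp]] := @segment_compact R (- C) C _ (fmap_proper_filter a _) FI.
exists p => V pV; have [//|aV] := in_ultra_setVsetC (a @^-1` V) UU.
have [x [nVx Vx]] := clp (~` V) V aV pV.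
by have := nVx Vx.
Qed.

(** Recursive choice, with the previous index as the lower bound for the next one. It turns
    convergence along an ultrafilter into convergence of a subsequence. *)
Lemma sequence_of_frequently (P : nat -> nat -> Prop) :
  (forall k N, exists2 n, (N < n)%N & P k n) ->
  exists s : nat -> nat, {homo s : m n / (m < n)%N >-> (m < n)%N} /\ forall k, P k (s k).
Proof.
move=> H.
have /choice[g gP] : forall kN : nat * nat, exists n, (kN.2 < n)%N /\ P kN.1 n.
  by move=> [k N]; have [n Nn Pn] := H k N; exists n.
pose s := fix s k := if k is k'.+1 then g (k, s k') else g (0%N, 0%N).
exists s; split; last by case=> [|k]; [exact: (gP (0, 0)%N).2|exact: (gP (k.+1, s k)).2].
by apply: homo_ltn => [|k]; [exact: ltn_trans|exact: (gP (k.+1, s k)).1].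
Qed.

(** * Functions on a metric graph *)

Section graph.
Context {R : realType} {G : metric_graph R}.
Notation mu := (@lebesgue_measure R).
Implicit Types (f g : graph_point G -> R[i]) (e : edge G) (x y : R) (b : bool).

Definition edge_sqL2 f e : \bar R := sqL2norm `]0%R, len e[ (on_edge f e).
Definition edge_sqH1 f e : \bar R := sqH1norm_interval (len e) (on_edge f e).

Lemma edge_sqL2_ge0 f e : (0 <= edge_sqL2 f e)%E.
Proof. exact: sqL2norm_ge0. Qed.

Lemma edge_sqH1_ge0 f e : (0 <= edge_sqH1 f e)%E.
Proof. by rewrite adde_ge0// sqL2norm_ge0. Qed.

Lemma edge_sqL2_le_H1 f e : (edge_sqL2 f e <= edge_sqH1 f e)%E.
Proof. by rewrite leeDl// sqL2norm_ge0. Qed.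

Lemma edge_ptE e x (xe : 0 < x < len e) : edge_pt e x = @Inner R G e (exist _ x xe).
Proof.
have /andP[x0 _] := xe; rewrite /edge_pt leNgt x0/=.
by rewrite insubT; congr Inner; exact: val_inj.
Qed.

Lemma L2normTE f : L2norm setT f = sqrte (\esum_(e in [set: edge G]) edge_sqL2 f e).
Proof.
by congr sqrte; apply: eq_esum => e _; rewrite preimage_setT setIT.
Qed.

(** The integrals run over open edges, and an interior point lies in the support exactly when its
    edge belongs to [H]; vertices do not contribute. *)
Lemma L2norm_supportCE (H : subgraph G) f : L2norm (~` support_of H) f =
  sqrte (\esum_(e in ~` sub_edge H) edge_sqL2 f e).
Proof.
congr sqrte; rewrite [RHS]esum_mkcond; apply: eq_esum => e _.
have pt x : x \in `]0, len e[ -> support_of H (edge_pt e x) = sub_edge H e.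
  by rewrite in_itv/= => xe; rewrite (edge_ptE xe).
rewrite in_setC; have [eH|eH] := boolP (e \in sub_edge H) => /=.
  rewrite (_ : _ `&` _ = set0) ?/sqL2norm ?integral_set0//.
  by apply/seteqP; split => // x /= [xe]; apply; rewrite pt//; exact: set_mem.
congr sqL2norm; apply/seteqP; split => [x [] //|x /= xe]; split => //.
by rewrite pt// => /mem_set; exact/negP.
Qed.

Lemma sqrte_le_fin (a : \bar R) (r : R) : (0 <= a)%E -> 0 <= r ->
  (sqrte a <= r%:E)%E = (a <= (r ^+ 2)%:E)%E.
Proof.
move=> a0 r0; have -> : r%:E = sqrte (r ^+ 2)%:E.
  by rewrite /sqrte sqrtr_sqr ger0_norm.
by rewrite lee_sqrt// lee_fin sqr_ge0.
Qed.

(** The segment between the two points is itself a path, so the edge parametrization is 1-Lipschitz;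
    a route through other edges may be shorter. *)
Lemma graph_dist_edge e x y : x \in `[0, len e] -> y \in `[0, len e] ->
  (graph_dist (edge_pt e x) (edge_pt e y) <= `|x - y|%:E)%E.
Proof.
move=> xe ye; apply: ereal_inf_lbound; exists `|x - y| => //=.
by rewrite -[`|x - y|]addr0; apply: path_cons => //; exact: path_nil.
Qed.

Lemma norm_reim_le b (z : R[i]) : `|reim b z| <= Num.sqrt (sqmod z).
Proof. by rewrite -sqrtr_sqr ler_wsqrtr// sqr_reim_le. Qed.

Lemma continuous_reim_on_edge f e b : continuous_on_graph f ->
  {in `]0, len e[, continuous (fun x => reim b (on_edge f e x))}.
Proof.
move=> cf x xe; apply/cvgrPdist_lt => eps eps0.
have [d d0 dP] := cf (edge_pt e x) _ eps0.
near=> y; rewrite distrC -reimB; apply: le_lt_trans (norm_reim_le _ _) _.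
apply: dP; apply: le_lt_trans (graph_dist_edge _ _) _.
- exact: subset_itv_oo_cc.
- apply: subset_itv_oo_cc; near: y; exact: near_in_itvoo.
- by rewrite lte_fin; near: y; exact: cvgr_dist_lt.
Unshelve. all: by end_near.
Qed.

Section H1_functions.
Context (k : scalar_field).

Lemma Cmeasurable_H1 f e : H1_space k f -> Cmeasurable_fun `]0, len e[ (on_edge f e).
Proof. by case=> _ _ /(_ e)[[]]. Qed.

Lemma edge_sqH1Z f e (c : R) : H1_space k f -> H1_space k (fun p => c%:C%C * f p) ->
  edge_sqH1 (fun p => c%:C%C * f p) e = ((c ^+ 2)%:E * edge_sqH1 f e)%E.
Proof.
move=> [_ cf /(_ e) Hf _] [_ _ /(_ e) Hcf _].
by apply: sqH1norm_intervalZ => // b; exact: continuous_reim_on_edge.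
Qed.

Lemma H1norm_leP f (M : R) : 0 <= M -> (H1norm f <= M%:E)%E <->
  (\esum_(e in [set: edge G]) edge_sqH1 f e <= (M ^+ 2)%:E)%E.
Proof.
by move=> M0; rewrite -sqrte_le_fin//; apply: esum_ge0 => e _; exact: edge_sqH1_ge0.
Qed.

(** Normalization into the unit ball, where the tail condition is stated. *)
Lemma H1norm_scale_le1 f (M : R) : 0 < M -> H1_space k f ->
  H1_space k (fun p => (M^-1)%:C%C * f p) -> (H1norm f <= M%:E)%E ->
  (H1norm (fun p => (M^-1)%:C%C * f p)%R <= 1)%E.
Proof.
move=> M0 Hf HMf /(H1norm_leP _ (ltW M0)) fM.
apply/(H1norm_leP _ ler01).
rewrite (eq_esum (b := fun e => ((M^-1 ^+ 2)%:E * edge_sqH1 f e)%E)); last first.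
  by move=> e _; exact: edge_sqH1Z.
apply: le_trans (esumZl_le _ (edge_sqH1_ge0 f) _) _; first exact: sqr_ge0.
apply: le_trans (lee_wpmul2l _ fM) _; first by rewrite lee_fin sqr_ge0.
by rewrite -EFinM lee_fin -exprMn mulVf ?gt_eqF.
Qed.

Lemma edge_sqL2Z f e (c : R) : H1_space k f ->
  edge_sqL2 (fun p => c%:C%C * f p) e = ((c ^+ 2)%:E * edge_sqL2 f e)%E.
Proof. by move=> Hf; apply: sqL2normZ => //; exact: Cmeasurable_H1. Qed.

End H1_functions.

Lemma edge_sqL2_sub_le2 f g e :
  Cmeasurable_fun `]0, len e[ (on_edge f e) ->
  Cmeasurable_fun `]0, len e[ (on_edge g e) ->
  (edge_sqL2 f e <= 2%:E * edge_sqL2 g e + 2%:E * edge_sqL2 (fun p => f p - g p)%R e)%E.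
Proof. by move=> mf mg; exact: sqL2norm_le2. Qed.

Lemma edge_sqL2_subC f g e :
  edge_sqL2 (fun p => f p - g p) e = edge_sqL2 (fun p => g p - f p) e.
Proof.
apply: eq_integral => x _; rewrite /on_edge !sqmodE !reimB.
by rewrite -(opprB (reim true _)) -(opprB (reim false _)) !sqrrN.
Qed.

(** The squared triangle inequality for [f - g] with reference [f], since [(f - g) - f = - g]. *)
Lemma edge_sqL2B_le2 f g e :
  Cmeasurable_fun `]0, len e[ (on_edge f e) ->
  Cmeasurable_fun `]0, len e[ (on_edge g e) ->
  (edge_sqL2 (fun p => f p - g p)%R e <= 2%:E * edge_sqL2 f e + 2%:E * edge_sqL2 g e)%E.
Proof.
move=> mf mg; have -> : edge_sqL2 g e = edge_sqL2 (fun p => f p - g p - f p) e.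
  apply: eq_integral => x _; rewrite /on_edge !sqmodE !reimB.
  by rewrite !(addrC (reim _ _ - _)) !addKr !sqrrN.
by apply: edge_sqL2_sub_le2 => //; exact: CmeasurableB.
Qed.

(** An exhaustion of the graph by finitely many edges at a time. Finiteness concerns edges only, so
    all vertices are kept and the incidence conditions become trivial. *)
Definition initial_subgraph (n : nat) : subgraph G :=
  @Subgraph R G setT [set e | (pickle e < n)%N] (fun _ _ => I) (fun _ _ => I).

Lemma initial_subgraph_finite n : finite_subgraph (initial_subgraph n).
Proof. exact: finite_pickle_lt. Qed.

(** * Compactness implies uniform tails *)

Lemma compact_embedding_tails (k : scalar_field) (K : set (graph_point G -> R[i])) :
  K `<=` H1_space k -> compact_embedding_L2 k K ->
  forall eps : R, 0 < eps -> exists2 Gc : subgraph G, finite_subgraph Gc &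
     forall f, K f -> (H1norm f <= 1)%E ->
       (L2norm (~` support_of Gc) f <= eps%:E)%E.
Proof.
move=> KH cK eps eps0; apply: contrapT => noGc.
have bad n : exists f, [/\ K f, (H1norm f <= 1)%E &
    ~ (L2norm (~` support_of (initial_subgraph n)) f <= eps%:E)%E].
  apply: contrapT => nof; apply: noGc; exists (initial_subgraph n).
    exact: initial_subgraph_finite.
  by move=> f Kf f1; apply: contrapT => nf; apply: nof; exists f.
have /choice[f_ f_P] := bad.
have [||s [f [s_mono [_ mf f2] cv]]] := cK f_.
- by move=> n; have [] := f_P n.
- by exists 1 => n; have [] := f_P n.
(* The tail of [f] and the squared distance to [f] are each bounded by [eps ^+ 2 / 8]; weighted by 2
   they add up to [eps ^+ 2 / 2]. *)
have dl0 : 0 < eps ^+ 2 / 8 by rewrite divr_gt0// exprn_gt0.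
have fsum : (\esum_(e in [set: edge G]) edge_sqL2 f e < +oo)%E.
  have s0 : (0 <= \esum_(e in [set: edge G]) edge_sqL2 f e)%E.
    by apply: esum_ge0 => e _; exact: edge_sqL2_ge0.
  move: f2; rewrite L2normTE -!ge0_fin_numE ?sqrte_ge0//.
  by rewrite sqrte_fin_num.
have [N fN] := esum_tail (edge_sqL2_ge0 f) fsum dl0.
(* Hence, for [n >= N], the edges outside the subgraph of index [s n] lie in the tail where [f] is
   small. *)
have s_ge n : (n <= s n)%N.
  by elim: n => // n IH; exact: leq_ltn_trans IH (s_mono _ _ (ltnSn n)).
have sq0 : 0 < Num.sqrt (eps ^+ 2 / 8) by rewrite sqrtr_gt0.
have near_s : \forall n \near \oo,
    (L2norm setT (fun p => f_ (s n) p - f p)%R <= (Num.sqrt (eps ^+ 2 / 8))%:E)%E.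
  have := cv; move/fine_cvgP => [fin /cvgr0_norm_le/(_ _ sq0)].
  apply: filterS2 fin => n fin; rewrite /= ger0_norm ?fine_ge0 ?sqrte_ge0//.
  by rewrite -lee_fin fineK.
have [n0 _ n0P] := near_s.
pose n := maxn n0 N.
have := n0P n (leq_maxl _ _); rewrite L2normTE sqrte_le_fin ?sqrtr_ge0//; last first.
  by apply: esum_ge0 => e _; exact: edge_sqL2_ge0.
rewrite sqr_sqrtr ?(ltW dl0)// => fn.
have [Kfn _] := f_P (s n); apply.
rewrite L2norm_supportCE sqrte_le_fin ?(ltW eps0)//; last first.
  by apply: esum_ge0 => e _; exact: edge_sqL2_ge0.
apply: (@le_trans _ _ (2 * (eps ^+ 2 / 8) + 2 * (eps ^+ 2 / 8))%:E); last first.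
  by rewrite lee_fin; have := sqr_ge0 eps; move: (eps ^+ 2) => z; lra.
apply: (esum_le2 (edge_sqL2_ge0 f) (edge_sqL2_ge0 (fun p => f_ (s n) p - f p))).
- move=> e; apply: edge_sqL2_sub_le2 (mf e).
  exact: (Cmeasurable_H1 _ (KH _ Kfn)).
- apply: le_trans fN; apply: esum_sub; first exact: edge_sqL2_ge0.
  apply: subsetC => e /= /leq_trans; apply.
  by apply: leq_trans (s_ge n); exact: leq_maxr.
- by apply: le_trans fn; apply: esum_sub => //; exact: edge_sqL2_ge0.
Qed.

End graph.

(** * Compactness along an ultrafilter *)

(** Midpoints of equal cells of width at most [d]; unlike the cell endpoints, they all stay inside
    the open interval. *)
Lemma finite_net (R : realType) (l d : R) : 0 < l -> 0 < d ->
  exists N (t : 'I_N -> R), (forall i, t i \in `]0, l[) /\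
    forall x, x \in `]0, l[ -> exists i, `|x - t i| <= d.
Proof.
move=> l0 d0; pose n := Num.truncn (l / d); pose w := l / n.+1%:R.
have w0 : 0 < w by rewrite divr_gt0.
have wd : w <= d.
  rewrite ler_pdivrMr// mulrC -ler_pdivrMr//.
  by have /andP[_ /ltW] := truncn_itv (ltW (divr_gt0 l0 d0)).
have lE : l = w * n.+1%:R by rewrite divfK.
exists n.+1, (fun i => w * (i%:R + 2^-1)); split=> [i|x].
  rewrite in_itv/= mulr_gt0 ?ltr_wpDl ?invr_gt0//= lE ltr_pM2l//.
  have : i.+1%:R <= n.+1%:R :> R by rewrite ler_nat.
  by rewrite -natr1; lra.
rewrite in_itv/= => /andP[x0 xl].
have /andP[mx xm] := truncn_itv (ltW (divr_gt0 x0 w0)).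
set m := Num.truncn (x / w) in mx xm.
have mn : (m < n.+1)%N.
  rewrite -(ltr_nat R) (le_lt_trans mx)// ltr_pdivrMr// mulrC -lE//.
exists (Ordinal mn); apply: le_trans wd => /=.
have -> : x - w * (m%:R + 2^-1) = w * (x / w - m%:R - 2^-1).
  have : w != 0 by rewrite gt_eqF.
  by move=> ?; field.
rewrite normrM gtr0_norm// ler_piMr// ?(ltW w0)//.
move: xm mx; rewrite -natr1 ler_norml; move: (x / w) (m%:R : R) => p q; lra.
Qed.

(* Equicontinuity upgrades pointwise convergence to uniform convergence; the
   modulus [s * A + |x - y| / s], valid for every [s > 0], is the one obtained
   from a bound [A] on the energy. *)
Section equicontinuous.
Context {R : realType} (U : set_system nat) {UP : ProperFilter U}.
Context (l A : R) (u_ : nat -> R -> R[i]) (u : R -> R[i]).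
Context (l0 : 0 < l) (A0 : 0 <= A).
Context (u_modulus : forall n b (s x y : R), 0 < s -> x \in `]0, l[ -> y \in `]0, l[ ->
  `|reim b (u_ n x) - reim b (u_ n y)| <= s * A + `|x - y| / s).
Context (u_cvg : forall b (x : R), x \in `]0, l[ ->
  reim b (u_ n x) @[n --> U] --> reim b (u x)).

Let limit_modulus b (s x y : R) : 0 < s -> x \in `]0, l[ -> y \in `]0, l[ ->
  `|reim b (u x) - reim b (u y)| <= s * A + `|x - y| / s.
Proof.
move=> s0 xI yI; have cv := cvg_norm (cvgB (@u_cvg b x xI) (@u_cvg b y yI)).
apply: (cvgr_to_le (cv _ _)).
by apply: filterE => n; exact: u_modulus.
Qed.

(** First [s] makes [s * A] at most [e / 2], then [d] makes [r / s] at most [e / 2]. Dividing by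
    [A + 1] covers [A = 0]. *)
Let modulus_small (e : R) : 0 < e -> exists s d : R, [/\ 0 < s, 0 < d &
  forall r, r <= d -> s * A + r / s <= e].
Proof.
move=> e0; pose s := e / (2 * (A + 1)).
have A1 : 0 < 2 * (A + 1) by rewrite mulr_gt0// ltr_wpDl.
have s0 : 0 < s by rewrite divr_gt0.
exists s, (s * (e / 2)); split=> //; first by rewrite mulr_gt0// divr_gt0.
move=> r rd; have : r / s <= e / 2 by rewrite ler_pdivrMr// mulrC.
have : s * A <= e / 2.
  have -> : e / 2 = s * (A + 1).
    by rewrite /s; field; rewrite gt_eqF// ltr_wpDl.
  by rewrite ler_wpM2l ?(ltW s0)// lerDl.
lra.
Qed.

(** The limit inherits the modulus, hence its components are continuous on the open interval. *)
Lemma equicontinuous_limit_measurable : Cmeasurable_fun `]0, l[ u.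
Proof.
apply/CmeasurableP => b; apply: open_continuous_measurable_fun.
  exact: interval_open.
move=> x xI; move: (xI) => /set_mem/= {}xI; apply/cvgrPdist_le => e e0.
have [s [d [s0 d0 sd]]] := modulus_small e0.
near=> y; apply: le_trans (@limit_modulus b _ _ _ s0 xI _) _.
  near: y; exact: near_in_itvoo.
by apply: sd; near: y; exact: cvgr_dist_le.
Unshelve. all: by end_near.
Qed.

(** Three terms of size [e / 3]: go from [x] to a nearby net point along [u_ n] and along [u], and
    compare the two at the net point. *)
Lemma equicontinuous_uniform_cvg (e : R) : 0 < e ->
  \forall n \near U, forall b x, x \in `]0, l[ -> `|reim b (u_ n x - u x)| <= e.
Proof.
move=> e0; have e3 : 0 < e / 3 by rewrite divr_gt0.
have [s [d [s0 d0 sd]]] := modulus_small e3.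
have [N [t [tI tnet]]] := finite_net l0 d0.
(* Finitely many net points and two components: a finite intersection of members of [U]. *)
have : \forall n \near U, forall (i : 'I_N) b,
    `|reim b (u (t i)) - reim b (u_ n (t i))| <= e / 3.
  apply: filter_forall => i; apply: filter_forall => b.
  by have /cvgrPdist_le/(_ _ e3) := @u_cvg b _ (tI i).
apply: filterS => n H b x xI; have [i xi] := tnet _ xI.
rewrite reimB.
have h1 := le_trans (@u_modulus n b _ _ _ s0 xI (tI i)) (sd _ xi).
have h2 := le_trans (@limit_modulus b _ _ _ s0 xI (tI i)) (sd _ xi).
have := H i b; move: h1 h2; rewrite !ler_norml.
move: (reim b _) (reim b _) (reim b _) (reim b _) => p q r v.
by move=> /andP[? ?] /andP[? ?] /andP[? ?]; apply/andP; split; lra.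
Qed.

Lemma equicontinuous_L2_cvg (e : R) : (forall n, Cmeasurable_fun `]0, l[ (u_ n)) ->
  0 < e -> \forall n \near U, (sqL2norm `]0%R, l[ (fun x => u_ n x - u x)%R <= e%:E)%E.
Proof.
(* Chosen so that $2d^2l=e$, the bound given by [sqL2norm_bounded]. *)
move=> mu_ e0; pose d := Num.sqrt (e / (2 * l)).
have d0 : 0 < d by rewrite sqrtr_gt0 divr_gt0// mulr_gt0.
have := equicontinuous_uniform_cvg d0; apply: filterS => n H.
apply: le_trans (sqL2norm_bounded l0 (ltW d0) _ H) _.
  exact: CmeasurableB (mu_ n) equicontinuous_limit_measurable.
rewrite lee_fin sqr_sqrtr; last by rewrite divr_ge0 ?mulr_ge0// ltW.
have : l != 0 by rewrite gt_eqF.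
by move=> ?; rewrite le_eqVlt; apply/orP; left; apply/eqP; field.
Qed.

End equicontinuous.

(** * Uniform tails imply compactness *)

Section tails_compact.
Context {R : realType} {G : metric_graph R}.
Implicit Types (x : R) (f : graph_point G -> R[i]) (e : edge G) (J : set (edge G)).

(** Undoes the normalization by writing [f] as [M] times its rescaled version. *)
Lemma scaled_tail (k : scalar_field) f (J : subgraph G) (M eps : R) :
  0 < M -> 0 <= eps -> H1_space k f ->
  (L2norm (~` support_of J) (fun p => (M^-1)%:C%C * f p)%R <= eps%:E)%E ->
  (\esum_(e in ~` sub_edge J) edge_sqL2 f e <= ((M * eps) ^+ 2)%:E)%E.
Proof.
move=> M0 eps0 Hf; rewrite L2norm_supportCE sqrte_le_fin//; last first.
  by apply: esum_ge0 => e _; exact: edge_sqL2_ge0.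
move=> fe; rewrite (eq_esum (b := fun e =>
    ((M ^+ 2)%:E * edge_sqL2 (fun p => (M^-1)%:C%C * f p)%R e)%E)); last first.
  move=> e _; rewrite (edge_sqL2Z _ _ Hf) muleA -EFinM -exprMn divff ?gt_eqF//.
  by rewrite expr1n mul1e.
apply: le_trans (esumZl_le _ _ _) _; [exact: edge_sqL2_ge0|exact: sqr_ge0|].
by rewrite exprMn (EFinM (M ^+ 2)) lee_wpmul2l// lee_fin sqr_ge0.
Qed.

Section limit.
Context (k : scalar_field) (U : set_system nat) {UU : UltraFilter U}.
Context (f_ : nat -> graph_point G -> R[i]) (M : R).
Context (M0 : 0 < M) (f_H1 : forall n, H1_space k (f_ n)).
Context (f_M : forall n, (H1norm (f_ n) <= M%:E)%E).

Let edge_bound n e : (edge_sqH1 (f_ n) e <= (M ^+ 2)%:E)%E.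
Proof.
have /(H1norm_leP _ (ltW M0)) := f_M n; apply: le_trans.
by apply: le_esum_term => // {}e; exact: edge_sqH1_ge0.
Qed.

Let f_cont n e b : {in `]0, len e[, continuous (fun x => reim b (on_edge (f_ n) e x))}.
Proof. by case: (f_H1 n) => _ cf _ _; exact: continuous_reim_on_edge. Qed.

Let f_int n e : H1_interval (len e) (on_edge (f_ n) e).
Proof. by case: (f_H1 n). Qed.

Definition component_limit b p : R :=
  xget 0 [set c : R | reim b (f_ n p) @[n --> U] --> c].

(** Vertices get the value 0: the convergence below is established at interior points, and the norm
    of $L^2$ does not see the vertices. *)
Definition ultralimit p : R[i] := if p is Inner _ _ then
  Complex (component_limit true p) (component_limit false p) else 0.

Let component_limitP b e x : x \in `]0, len e[ ->
  reim b (on_edge (f_ n) e x) @[n --> U] --> component_limit b (edge_pt e x).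
Proof.
move=> xe; have [c cP] : exists c : R, reim b (on_edge (f_ n) e x) @[n --> U] --> c.
  (* The constant is that of [H1_bound] with energy bound [M ^+ 2], so it does not depend on [n]. *)
  apply: (@ultra_bounded_cvg _ _ _ (M ^+ 2 + len e + (M ^+ 2 / len e + 1))) => n.
  apply: H1_bound (edge_bound n e) xe => [|b'|];
    [exact: len_gt0|exact: f_cont|exact: f_int].
exact: (@xgetPex _ 0 [set c : R | reim b (on_edge (f_ n) e x) @[n --> U] --> c]
  (ex_intro _ c cP)).
Qed.

Let ultralimit_cvg b e x : x \in `]0, len e[ ->
  reim b (on_edge (f_ n) e x) @[n --> U] --> reim b (on_edge ultralimit e x).
Proof.
move=> xe; have := @component_limitP b _ _ xe; move: xe.
by rewrite in_itv/= /on_edge => xe; rewrite (edge_ptE xe); case: b.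
Qed.

Let f_modulus e n b (s x y : R) : 0 < s -> x \in `]0, len e[ -> y \in `]0, len e[ ->
  `|reim b (on_edge (f_ n) e x) - reim b (on_edge (f_ n) e y)| <=
  s * M ^+ 2 + `|x - y| / s.
Proof.
by move=> s0 xe ye; apply: H1_modulus s0 xe ye;
  [exact: f_cont|exact: f_int|exact: edge_bound].
Qed.

Lemma ultralimit_measurable e : Cmeasurable_fun `]0, len e[ (on_edge ultralimit e).
Proof.
exact: (equicontinuous_limit_measurable (sqr_ge0 M) (@f_modulus e)
  (fun b x => @ultralimit_cvg b e x)).
Qed.

Lemma ultralimit_edge_cvg e (eps : R) : 0 < eps ->
  \forall n \near U, (edge_sqL2 (fun p => f_ n p - ultralimit p)%R e <= eps%:E)%E.
Proof.
move=> eps0; apply: (equicontinuous_L2_cvg (len_gt0 e) (sqr_ge0 M) (@f_modulus e)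
  (fun b x => @ultralimit_cvg b e x)) => // n.
exact: Cmeasurable_H1 (f_H1 n).
Qed.

Lemma ultralimit_finite_cvg J (eps : R) : finite_set J -> 0 < eps ->
  \forall n \near U,
    (\esum_(e in J) edge_sqL2 (fun p => f_ n p - ultralimit p)%R e <= eps%:E)%E.
Proof.
move=> Jf eps0; have : \forall n \near U,
    (\sum_(e <- finmap.enum_fset (fset_set J))
       edge_sqL2 (fun p => f_ n p - ultralimit p)%R e <= eps%:E)%E.
  elim: (finmap.enum_fset _) eps eps0 => [|e r IH] eps eps0.
    by apply: filterE => n; rewrite big_nil lee_fin ltW.
  have eps2 : 0 < eps / 2 by rewrite divr_gt0.
  have := IH _ eps2; have := ultralimit_edge_cvg e eps2.
  apply: filterS2 => n he hr; rewrite big_cons.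
  by have := leeD he hr; rewrite -EFinD -splitr.
apply: filterS => n; rewrite esum_fset//.
  by rewrite fsbig_finite.
by move=> e _; exact: edge_sqL2_ge0.
Qed.

Lemma ultralimit_scalars p : scalars k (ultralimit p).
Proof.
have : forall n, scalars k (f_ n p) by move=> n; case: (f_H1 n).
case: k => //= H; case: p H => [//|e [x xe]] H /=.
have xI : x \in `]0, len e[ by rewrite in_itv.
have := @component_limitP false e x xI; rewrite /on_edge (edge_ptE xe).
rewrite (_ : (fun n => _) = fun=> 0); last by apply/funext => n; exact: H.
by move=> /(cvg_unique (@Rhausdorff R)); apply; exact: cvg_cst.
Qed.

(** On a finite set of edges some [f_ n] is [eps]-close to the limit in squared norm, which gives
    [2 * eps + 2 * eps]. The index depends on the finite set, the bound does not, so the supremum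
    obeys it too. *)
Lemma ultralimit_tail J (eps : R) : 0 < eps ->
  (forall n, \esum_(e in J) edge_sqL2 (f_ n) e <= eps%:E)%E ->
  (\esum_(e in J) edge_sqL2 ultralimit e <= (4 * eps)%:E)%E.
Proof.
move=> eps0 Jeps; apply: esum_le_ub => X [Xf XJ].
have [n Xn] := filter_ex (ultralimit_finite_cvg Xf eps0).
rewrite -esum_fset// => [|e _]; last exact: edge_sqL2_ge0.
have -> : 4 * eps = 2 * eps + 2 * eps by ring.
apply: (esum_le2 (edge_sqL2_ge0 (f_ n))
  (edge_sqL2_ge0 (fun p => f_ n p - ultralimit p)%R)) => //.
- move=> e; rewrite edge_sqL2_subC; apply: edge_sqL2_sub_le2.
    exact: ultralimit_measurable.
  exact: Cmeasurable_H1 (f_H1 n).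
- by apply: le_trans (Jeps n); apply: esum_sub => //; exact: edge_sqL2_ge0.
Qed.

Lemma ultralimit_cvgL2 :
  (forall eps : R, 0 < eps -> exists2 J, finite_set J & forall n,
    (\esum_(e in ~` J) edge_sqL2 (f_ n) e <= eps%:E)%E) ->
  forall eps : R, 0 < eps -> \forall n \near U,
    (\esum_(e in [set: edge G]) edge_sqL2 (fun p => f_ n p - ultralimit p)%R e
       <= eps%:E)%E.
Proof.
(* Outside [J] the tails of [f_ n] and of the limit, at most [eps / 20] and [4 * (eps / 20)], are
   doubled and sum to [eps / 2]; the other half is spent on [J]. *)
move=> tails eps eps0; have d0 : 0 < eps / 20 by rewrite divr_gt0.
have [J Jf Jt] := tails _ d0; have Jlim := ultralimit_tail d0 Jt.
have eps2 : 0 < eps / 2 by rewrite divr_gt0.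
have := ultralimit_finite_cvg Jf eps2; apply: filterS => n hJ.
have q0 := edge_sqL2_ge0 (fun p => f_ n p - ultralimit p)%R.
rewrite (esumID J)// !setTI.
have hJC : (\esum_(e in ~` J) edge_sqL2 (fun p => f_ n p - ultralimit p)%R e <=
    (2 * (eps / 20) + 2 * (4 * (eps / 20)))%:E)%E.
  apply: (esum_le2 (edge_sqL2_ge0 (f_ n)) (edge_sqL2_ge0 ultralimit)) => // e.
  have mf : Cmeasurable_fun `]0, len e[ (on_edge (f_ n) e).
    exact: Cmeasurable_H1 (f_H1 n).
  have ml := ultralimit_measurable e.
  exact: edge_sqL2B_le2.
apply: le_trans (leeD hJ hJC) _; rewrite -EFinD lee_fin; lra.
Qed.

End limit.
End tails_compact.

Lemma tails_compact_embedding (R : realType) (G : metric_graph R) (k : scalar_field)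
    (K : set (graph_point G -> R[i])) :
  K `<=` H1_space k -> (forall c f, scalars k c -> K f -> K (fun p => c * f p)) ->
  (forall eps : R, 0 < eps -> exists2 Gc : subgraph G, finite_subgraph Gc &
     forall f, K f -> (H1norm f <= 1)%E ->
       (L2norm (~` support_of Gc) f <= eps%:E)%E) ->
  compact_embedding_L2 k K.
Proof.
move=> KH KZ tails f_ Kf [M0 fM0].
(* The normalization divides by the bound, so it must be positive. *)
pose M := Num.max M0 1.
have M_gt0 : 0 < M by rewrite lt_max ltr01 orbT.
have fM n : (H1norm (f_ n) <= M%:E)%E.
  by apply: le_trans (fM0 n) _; rewrite lee_fin le_max lexx.
have fH n := KH _ (Kf n).
have [U [UU ooU]] := @ultraFilterLemma nat \oo _.
have edge_tails (eps : R) : 0 < eps -> exists2 J : set (edge G), finite_set J & forall n,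
    (\esum_(e in ~` J) edge_sqL2 (f_ n) e <= eps%:E)%E.
  (* Undoing the normalization multiplies the tail norm by [M], and squaring it then gives [eps]. *)
  move=> eps0; have d0 : 0 < Num.sqrt eps / M by rewrite divr_gt0// sqrtr_gt0.
  have [Gc Gcf GcP] := tails _ d0; exists (sub_edge Gc) => // n.
  have KMf : K (fun p => (M^-1)%:C%C * f_ n p) by apply: KZ => //; case: (k).
  have := GcP _ KMf (H1norm_scale_le1 M_gt0 (fH n) (KH _ KMf) (fM n)).
  move=> /(scaled_tail M_gt0 (ltW d0) (fH n)).
  by rewrite mulrC divfK ?gt_eqF// sqr_sqrtr// ltW.
have cvgU := @ultralimit_cvgL2 _ _ _ U UU _ _ M_gt0 fH fM edge_tails.
have [k' N|s [s_mono sP]] := @sequence_of_frequently (fun k n =>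
    (L2norm setT (fun p => f_ n p - ultralimit U f_ p)%R <= (k.+1%:R^-1)%:E)%E).
  have k0 : 0 < (k'.+1%:R^-1 : R) ^+ 2 by rewrite exprn_gt0// invr_gt0.
  (* [U] refines the Frechet filter, so indices beyond any [N] remain available. *)
  have NU : U [set n | (N < n)%N] by apply: ooU; exact: nbhs_infty_gt.
  have [n [Nn nk]] := filter_ex (filterI NU (cvgU _ k0)).
  exists n => //; rewrite L2normTE sqrte_le_fin// ?invr_ge0//.
  by apply: esum_ge0 => e _; exact: edge_sqL2_ge0.
exists s, (ultralimit U f_); split => //.
- split => [p|e|].
  + exact: (ultralimit_scalars M_gt0 fH fM).
  + exact: (ultralimit_measurable M_gt0 fH fM).
  + apply: le_lt_trans (ltry (Num.sqrt (4 * M ^+ 2))).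
    rewrite L2normTE sqrte_le_fin ?sqrtr_ge0//; last first.
      by apply: esum_ge0 => e _; exact: edge_sqL2_ge0.
    rewrite sqr_sqrtr; last by apply: mulr_ge0 => //; exact: sqr_ge0.
    (* Square integrability of the limit is the tail estimate taken over all edges, with [M ^+ 2] as
       the bound. *)
    apply: (ultralimit_tail M_gt0 fH fM); first exact: exprn_gt0.
    move=> n; have /(H1norm_leP _ (ltW M_gt0)) := fM n; apply: le_trans.
    by apply: le_esum => e _; exact: edge_sqL2_le_H1.
- have cv0 : (n.+1%:R^-1 : R)%:E @[n --> \oo] --> 0%E.
    by apply: cvg_EFin; [exact: nearW|exact: cvg_harmonic].
  apply: (squeeze_cvge _ (cvg_cst 0%E) cv0).
  by apply: nearW => n; rewrite sP andbT; exact: sqrte_ge0.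
Qed.

Theorem theorem3p1 (R : realType) (k : scalar_field) (G : metric_graph R)
    (K : set (graph_point G -> R[i])) :
  locally_finite G -> connected_graph G -> closed_subspace_H1 k K ->
  compact_embedding_L2 k K <->
  (forall eps : R, 0 < eps -> exists2 Gc : subgraph G, finite_subgraph Gc &
     forall f, K f -> (H1norm f <= 1)%E ->
       (L2norm (~` support_of Gc) f <= eps%:E)%E).
Proof.
move=> _ _ [KH _ _ KZ _]; split; first exact: compact_embedding_tails.
exact: tails_compact_embedding.
Qed.
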